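(* Suppose $f\in H^1(\mathscr U)$. Then there exists $f^b\in\mathcal S'(\mathscr H_1\times\mathscr H_2)$ such that $f(\varepsilon_1,\varepsilon_2,\cdot)\to f^b$ in $\mathcal S'(\mathscr H_1\times\mathscr H_2)$ as $\varepsilon_1,\varepsilon_2\to0$ ($\varepsilon_1,\varepsilon_2>0$).
   Context: For $\alpha=1,2$ let $n_\alpha\ge1$ and let $\mathscr H_\alpha=\mathbb R\times\mathbb C^{n_\alpha}$ be the Heisenberg group with points $(s_\alpha,\mathbf z_\alpha)$, equipped with Lebesgue measure. $\mathcal S'(\mathscr H_1\times\mathscr H_2)$ is the space of tempered distributions on $\mathscr H_1\times\mathscr H_2$ (viewed as a Euclidean space); a function $F$ acts by $\psi\mapsto\int F\psi\,d\mathbf g$. $\mathscr U=\mathbb R_+^2\times\mathscr H_1\times\mathscr H_2$ ($\mathbb R_+=(0,\infty)$), points $(t_1,t_2,\mathbf g)$, also written $(w_1,w_2,\mathbf z_1,\mathbf z_2)$ with $w_\alpha=s_\alpha+\mathbf i t_\alpha$. Let $\mathcal U=\mathcal U_1\times\mathcal U_2$, $\mathcal U_\alpha=\{(\widetilde w_\alpha,\widetilde{\mathbf z}_\alpha)\in\mathbb C\times\mathbb C^{n_\alpha}:\mathrm{Im}\,\widetilde w_\alpha>|\widetilde{\mathbf z}_\alpha|^2\}$, $\pi:\mathscr U\to\mathcal U$, $(w_1,w_2,\mathbf z_1,\mathbf z_2)\mapsto(w_1+\mathbf i|\mathbf z_1|^2,w_2+\mathbf i|\mathbf z_2|^2,\mathbf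 z_1,\mathbf z_2)$. A function $f$ on $\mathscr U$ is holomorphic if $f\circ\pi^{-1}$ is holomorphic on $\mathcal U$. $H^1(\mathscr U)$ is the space of holomorphic $f$ on $\mathscr U$ with $\|f\|_{H^1(\mathscr U)}=\sup_{\mathbf t\in\mathbb R_+^2}\int_{\mathscr H_1\times\mathscr H_2}|f(\mathbf t,\mathbf g)|d\mathbf g<\infty$. *)

(* Defs.v *)
From HB Require Import structures.
From mathcomp Require Import all_boot all_order all_algebra.
From mathcomp Require Import complex.
From mathcomp Require Import all_classical all_reals all_analysis.

Set Implicit Arguments.
Unset Strict Implicit.
Unset Printing Implicit Defensive.

Import Order.TTheory GRing.Theory Num.Theory.
Import numFieldNormedType.Exports.

Import ComplexField.Normc.
Local Open Scope complex_scope.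
Local Open Scope classical_set_scope.
Local Open Scope ring_scope.

Section lebesgue_tuple.
Context {R : realType}.
Local Notation mR := (measurableTypeR R).

(* The new coordinate is the second component, so that the one-dimensional
   (sigma-finite) Lebesgue measure is the right factor of the product below. *)
Definition cons_pair (N : nat) (p : N.-tuple mR * mR) : N.+1.-tuple mR :=
  [tuple of p.2 :: p.1].

Lemma measurable_cons_pair N : measurable_fun setT (@cons_pair N).
Proof. by apply: measurable_cons; [exact: measurable_snd|exact: measurable_fst]. Qed.

Definition lebesgue_cons (N : nat) (m : {measure set (N.-tuple mR) -> \bar R}) :
    set (N.+1.-tuple mR) -> \bar R :=
  pushforward (m \x lebesgue_measure)%E (@cons_pair N).

Section lebesgue_cons_measure.
Variables (N : nat) (m : {measure set (N.-tuple mR) -> \bar R}).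

Let lebesgue_cons0 : lebesgue_cons m set0 = 0%E.
Proof. by rewrite /lebesgue_cons /pushforward preimage_set0 measure0. Qed.

Let lebesgue_cons_ge0 A : (0 <= lebesgue_cons m A)%E.
Proof. exact: (@measure_ge0 _ _ _
  (m \x lebesgue_measure)%E (@cons_pair N @^-1` A)). Qed.

Let lebesgue_cons_sigma_additive : semi_sigma_additive (lebesgue_cons m).
Proof.
by have := @measure_semi_sigma_additive _ _ _
  (measure_function_pushforward__canonical__measure_function_Measure
    (m \x lebesgue_measure)%E (@measurable_cons_pair N)).
Qed.

HB.instance Definition _ := isMeasure.Build _ _ _ (lebesgue_cons m)
  lebesgue_cons0 lebesgue_cons_ge0 lebesgue_cons_sigma_additive.

End lebesgue_cons_measure.

Fixpoint lebesgue_tuple (N : nat) : {measure set (N.-tuple mR) -> \bar R} :=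
  match N with
  | 0 => dirac ([tuple] : 0.-tuple mR)
  | N'.+1 => lebesgue_cons (lebesgue_tuple N')
  end.

Lemma measurable_box N (A : 'I_N -> set mR) : (forall i, measurable (A i)) ->
  measurable [set x : N.-tuple mR | forall i, A i (tnth x i)].
Proof.
move=> mA.
rewrite (_ : [set _ | _] = \bigcap_(i in [set: 'I_N]) ((@tnth N mR ^~ i) @^-1` A i)).
  apply: fin_bigcap_measurable => [|i _]; first exact: finite_finset.
  by rewrite -[X in measurable X]setTI; exact: measurable_tnth.
by apply/seteqP; split => x /= H i; [move=> _; exact: H|exact: H].
Qed.

Lemma lebesgue_tuple_box N (A : 'I_N -> set mR) : (forall i, measurable (A i)) ->
  lebesgue_tuple N [set x | forall i, A i (tnth x i)] =
  (\prod_(i < N) lebesgue_measure (A i))%E.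
Proof.
elim: N A => [|N IH] A mA /=.
  by rewrite big_ord0 diracE mem_set//= => -[].
rewrite /lebesgue_cons /pushforward.
rewrite (_ : _ @^-1` _ =
    [set x : N.-tuple mR | forall i, A (lift ord0 i) (tnth x i)] `*` A ord0).
  rewrite product_measure1E//; last exact: (measurable_box (fun i => mA (lift ord0 i))).
  by rewrite (IH (fun i => A (lift ord0 i)))// big_ord_recl muleC.
apply/seteqP; split => [[x r]/= H|[x r]/= [H H0] i].
  split=> [i|]; first by have := H (lift ord0 i); rewrite tnthS.
  by have := H ord0.
by case: (unliftP ord0 i) => [j|] ->; rewrite ?tnthS.
Qed.

End lebesgue_tuple.

Section euclidean.
Context {R : realType} {N : nat}.
Implicit Types (g : 'rV[R]_N -> R) (psi : 'rV[R]_N -> R[i]^o).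

Definition row_of_tuple (x : N.-tuple R) : 'rV[R]_N := \row_i tnth x i.

Definition integralC (F : 'rV[R]_N -> R[i]^o) : R[i]^o :=
  (\int[lebesgue_tuple N]_x complex.Re (F (row_of_tuple x)))
  +i* (\int[lebesgue_tuple N]_x complex.Im (F (row_of_tuple x))).

Definition partial (i : 'I_N) g : 'rV[R]_N -> R := 'D_(delta_mx 0 i) g.

(* Iterated partial derivative along a list of coordinate indices. *)
Definition partials (s : seq 'I_N) g : 'rV[R]_N -> R := foldr partial g s.

Definition smooth g := forall s : seq 'I_N,
  continuous (partials s g) /\
  forall x i, derivable (partials s g) x (delta_mx 0 i).

Definition monomial (a : {ffun 'I_N -> nat}) (x : 'rV[R]_N) : R :=
  \prod_i x 0 i ^+ a i.

Definition mpartial (b : {ffun 'I_N -> nat}) g : 'rV[R]_N -> R :=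
  partials (flatten [seq nseq (b i) i | i <- enum 'I_N]) g.

Definition mpartialC (b : {ffun 'I_N -> nat}) psi (x : 'rV[R]_N) : R[i] :=
  mpartial b (@complex.Re R \o psi) x +i* mpartial b (@complex.Im R \o psi) x.

Definition seminorm (ab : {ffun 'I_N -> nat} * {ffun 'I_N -> nat}) psi : \bar R :=
  ereal_sup (range (fun x => (normc (mpartialC ab.2 psi x) * `|monomial ab.1 x|)%:E)).

Definition schwartz psi :=
  [/\ smooth (@complex.Re R \o psi), smooth (@complex.Im R \o psi) &
      forall ab, (seminorm ab psi < +oo)%E].

(* Neighbourhoods of psi in the Schwartz space for the locally convex topology
   generated by the seminorms: finitely many seminorms, one radius. *)
Definition schwartz_nbhs psi : set_system ('rV[R]_N -> R[i]^o) :=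
  filter_from
    [set Ad : seq ({ffun 'I_N -> nat} * {ffun 'I_N -> nat}) * R | 0 < Ad.2]
    (fun Ad => [set phi | schwartz phi /\ forall ab, ab \in Ad.1 ->
       (seminorm ab (fun x => phi x - psi x)%R < Ad.2%:E)%E]).

(* Functionals are total on functions 'rV_N -> C; a tempered distribution is a
   functional whose restriction to the Schwartz space is linear and continuous,
   and its values outside the Schwartz space are irrelevant. *)
Definition tempered (u : ('rV[R]_N -> R[i]^o) -> R[i]^o) :=
  (forall (c : R[i]) phi psi, schwartz phi -> schwartz psi ->
     u (fun x => c * phi x + psi x) = c * u phi + u psi) /\
  (forall psi, schwartz psi -> u phi @[phi --> schwartz_nbhs psi] --> u psi).

Definition distribution_of (F : 'rV[R]_N -> R[i]^o) :
    ('rV[R]_N -> R[i]^o) -> R[i]^o :=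
  fun psi => integralC (fun x => F x * psi x).

(* Convergence in S' (weak-* topology) along the filter G. *)
Definition cvg_tempered {I : Type} (G : set_system I)
    (u : I -> ('rV[R]_N -> R[i]^o) -> R[i]^o)
    (v : ('rV[R]_N -> R[i]^o) -> R[i]^o) :=
  (\forall i \near G, tempered (u i)) /\
  forall psi, schwartz psi -> u i psi @[i --> G] --> v psi.

End euclidean.

Section heisenberg.
Context {R : realType}.

Definition heis (R : realType) (n : nat) : Type := (R * 'rV[R[i]]_n)%type.

(* R x C^n has 1 + 2n real coordinates (s, Re z, Im z); Lebesgue measure,
   Schwartz functions and distributions live on this coordinate space. *)
Definition heis_dim (n : nat) : nat := (1 + (n + n))%N.

Definition heis_of_row (n : nat) (x : 'rV[R]_(heis_dim n)) : heis R n :=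
  (lsubmx x 0 0,
   \row_j (lsubmx (rsubmx x) 0 j +i* rsubmx (rsubmx x) 0 j)).

Lemma heis_of_row_bij n : bijective (@heis_of_row n).
Proof.
exists (fun g => row_mx (g.1)%:M (row_mx (map_mx (@complex.Re R) g.2)
                                         (map_mx (@complex.Im R) g.2))).
  move=> x; rewrite -[RHS]hsubmxK -[X in _ = row_mx _ X]hsubmxK.
  congr (row_mx _ (row_mx _ _)); apply/rowP => j; rewrite !mxE/=;
    by rewrite ?[j]ord1 ?mulr1n ?mxE.
move=> [s z]; rewrite /heis_of_row row_mxKl row_mxKr row_mxKl row_mxKr.
congr (_, _); first by rewrite mxE mulr1n.
by apply/rowP => j; rewrite !mxE; case: (z 0 j).
Qed.

Definition normsq (n : nat) (z : 'rV[R[i]]_n) : R := \sum_j normc (z 0 j) ^+ 2.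

Definition siegel (n : nat) : set (R[i]^o * 'rV[R[i]^o]_n) :=
  [set p | normsq p.2 < complex.Im p.1].

Section product.
Variables n1 n2 : nat.

Definition heis2_of_row (x : 'rV[R]_(heis_dim n1 + heis_dim n2)) :
    heis R n1 * heis R n2 :=
  (heis_of_row (lsubmx x), heis_of_row (rsubmx x)).

Definition pos2 : set (R * R) := [set t | 0 < t.1 /\ 0 < t.2].

Definition scrU : set ((R * R) * (heis R n1 * heis R n2)) := [set p | pos2 p.1].

Definition calU : set ((R[i]^o * 'rV[R[i]^o]_n1) * (R[i]^o * 'rV[R[i]^o]_n2)) :=
  @siegel n1 `*` @siegel n2.

(* The factors of calU are grouped as (w1, z1), (w2, z2). *)
Definition pi_map (p : (R * R) * (heis R n1 * heis R n2)) :
    (R[i]^o * 'rV[R[i]^o]_n1) * (R[i]^o * 'rV[R[i]^o]_n2) :=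
  let: ((t1, t2), ((s1, z1), (s2, z2))) := p in
  ((s1 +i* t1 + (0 +i* normsq z1), z1), (s2 +i* t2 + (0 +i* normsq z2), z2)).

Definition pi_inv (q : (R[i]^o * 'rV[R[i]^o]_n1) * (R[i]^o * 'rV[R[i]^o]_n2)) :
    (R * R) * (heis R n1 * heis R n2) :=
  let: ((w1, z1), (w2, z2)) := q in
  ((complex.Im w1 - normsq z1, complex.Im w2 - normsq z2),
   ((complex.Re w1, z1), (complex.Re w2, z2))).

Lemma pi_mapK : cancel pi_map pi_inv.
Proof.
by move=> [[t1 t2] [[s1 z1] [s2 z2]]]/=; rewrite !addrK !addr0.
Qed.

Lemma pi_invK : cancel pi_inv pi_map.
Proof.
by move=> [[[x1 y1] z1] [[x2 y2] z2]] /=; simpc; rewrite !subrK.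
Qed.

Lemma pi_map_calU p : calU (pi_map p) <-> scrU p.
Proof.
move: p => [[t1 t2] [[s1 z1] [s2 z2]]].
by rewrite /calU /scrU /siegel /pos2 /= !ltrDr.
Qed.

(* [differentiable] is over the field R[i]: Frechet complex differentiability. *)
Definition holomorphic_scrU (f : (R * R) * (heis R n1 * heis R n2) -> R[i]^o) :=
  forall q, calU q -> differentiable (f \o pi_inv) q.

Definition slice (f : (R * R) * (heis R n1 * heis R n2) -> R[i]^o) (t : R * R) :
    'rV[R]_(heis_dim n1 + heis_dim n2) -> R[i]^o :=
  fun x => f (t, heis2_of_row x).

Definition hardy1_norm (f : (R * R) * (heis R n1 * heis R n2) -> R[i]^o) : \bar R :=
  ereal_sup [set (\int[lebesgue_tuple _]_x
                    (normc (slice f t (row_of_tuple x)))%:E)%E | t in pos2].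

Definition hardy1 (f : (R * R) * (heis R n1 * heis R n2) -> R[i]^o) :=
  holomorphic_scrU f /\ (hardy1_norm f < +oo)%E.

End product.
End heisenberg.

(* Main.v *)
Require Import Defs.
From HB Require Import structures.
From mathcomp Require Import all_boot all_order all_algebra.
From mathcomp Require Import complex.
From mathcomp Require Import all_classical all_reals all_analysis.
From mathcomp Require Import measurable_realfun ring lra.
Import Order.TTheory GRing.Theory Num.Theory.
Import numFieldNormedType.Exports.
Local Open Scope classical_set_scope.
Local Open Scope ring_scope.

(** For a Schwartz function [psi] put [F(t1, t2) = \int f(t1, t2, g) psi(g) dg].
    Since [f] is holomorphic in [w1 = s1 + i t1], the derivative in [t1] is
    [i] times the derivative in the central variable [s1], which can be moved
    onto [psi]; hence [F] is Lipschitz in [t1] with a constant depending only on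
    the norm of [f] in H^1 and on the supremum of the [s1]-derivative of [psi],
    and similarly in [t2].  So [F] has a limit at the corner [(0, 0)], and the
    limit is a tempered distribution because [|F|] is at most the H^1 norm times
    the supremum of [|psi|], up to a constant.

    The integration by parts needs neither decay nor continuity of the complex
    derivative: along each orbit of the translations in [s1], bisection as in
    Goursat's proof of Cauchy's theorem bounds the circulation of [f psi] around
    a square [[0, L] x [a, b]], [L = b - a], in the [(s1, t1)]-plane by the
    integral of [|f| |d psi / d s1|] over the square.  Integrating over all
    starting points, translation invariance cancels the two sides parallel to
    the [t1]-axis, and the other two sides give [L (F(b) - F(a))]. *)

Set Implicit Arguments.
Unset Strict Implicit.
Unset Printing Implicit Defensive.

(** * Lebesgue measure on tuples *)

(** The pushforward of [mu] under [th] agrees with [mu] on measurable sets, and integrating against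
    a pushforward is integrating a composition. *)
Lemma ge0_integral_preserving d (T : measurableType d) (R : realType)
    (mu : {measure set T -> \bar R}) (th : T -> T) (F : T -> \bar R) :
  measurable_fun setT th ->
  (forall A, measurable A -> mu (th @^-1` A) = mu A) ->
  measurable_fun setT F -> (forall x, 0 <= F x)%E ->
  (\int[mu]_x F (th x) = \int[mu]_x F x)%E.
Proof.
move=> mth muth mF F0.
pose m' := measure_function_pushforward__canonical__measure_function_Measure mu mth.
have <- : (\int[m']_x F x = \int[mu]_x F x)%E.
  by apply: eq_measure_integral => A mA _; exact: muth.
by rewrite (ge0_integral_pushforward mth).
Qed.

Lemma cvg_row (T : topologicalType) (N : nat) (I : Type) (F : set_system I)
    (f : I -> 'rV[T]_N) (l : 'rV[T]_N) : Filter F ->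
  (forall j, f x ord0 j @[x --> F] --> l ord0 j) -> f @ F --> l.
Proof.
move=> FF fl A [P lP PA].
have : \forall x \near F, forall j, P ord0 j (f x ord0 j).
  by apply: filter_forall => j; exact: fl.
by apply: filterS => x Px; apply: PA => i j; rewrite ord1.
Qed.

Section lebesgue_tuple_theory.
Context {R : realType}.
Local Notation mR := (measurableTypeR R).

(** The cubes [-k, k]^N exhaust the space and have finite measure. Fubini's theorem will require
    this. *)
Lemma lebesgue_tuple_sigma_finite (N : nat) :
  sigma_finite setT (@lebesgue_tuple R N).
Proof.
exists (fun k => [set x : N.-tuple mR | forall i, `[- k%:R, k%:R]%classic (tnth x i)]).
  apply/seteqP; split => // x _.
  exists (\max_i Num.truncn `|tnth x i|).+1 => // i /=.
  rewrite in_itv/= -ler_norml.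
  have /ltW h := truncnS_gt `|tnth x i|.
  by apply: (le_trans h); rewrite ler_nat ltnS (leq_bigmax (F := fun i => Num.truncn `|tnth x i|)).
move=> k; split; first by apply: (measurable_box (A := fun=> `[- k%:R, k%:R]%classic)) => i; exact: measurable_itv.
rewrite (lebesgue_tuple_box (A := fun=> `[- k%:R, k%:R]%classic)) //.
(* For k = 0 the length formula takes its degenerate branch, whose value 0 still equals k - (-k). *)
have -> : lebesgue_measure (`[- k%:R, k%:R]%classic : set mR) = (k%:R - - k%:R : R)%:E.
  rewrite lebesgue_measure_itv/= lte_fin; case: ltP => // /(conj (ler0n R k)).
  by rewrite opprK => -[k0]; rewrite lerNr => kN; congr EFin; lra.
by rewrite prodEFin ltry.
Qed.

(** Lebesgue measure is determined by its values on half-open intervals, and translation preserves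
    their lengths. *)
Lemma lebesgue_measure_shift (v : R) (A : set mR) : measurable A ->
  lebesgue_measure ((fun x : mR => x + v) @^-1` A) = lebesgue_measure A.
Proof.
move=> mA.
have mshift : measurable_fun setT (fun x : mR => x + v : mR).
  by apply: measurable_funD => //; exact: measurable_id.
apply/esym; apply: (lebesgue_measure_unique (mu := measure_function_pushforward__canonical__measure_function_Measure lebesgue_measure mshift)) => //.
move=> _ [[a b] _ <-] /=.
rewrite /pushforward (_ : _ @^-1` _ = `]a - v, b - v]%classic); last first.
  by apply/seteqP; split => x /=; rewrite !in_itv/= ltrBlDr lerBrDr.
by rewrite !lebesgue_measure_itv/= !lte_fin ltrD2r -!EFinD opprB addrA subrK.
Qed.

Definition tuple_shift (N : nat) (v : 'I_N -> R) (x : N.-tuple mR) : N.-tuple mR :=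
  [tuple tnth x i + v i | i < N].

Lemma measurable_tuple_shift (N : nat) (v : 'I_N -> R) :
  measurable_fun setT (tuple_shift v).
Proof.
apply/measurable_fun_tnthP => i.
rewrite (_ : _ \o _ = fun x => tnth x i + v i); last first.
  by apply/funext => x /=; rewrite tnth_mktuple.
by apply: measurable_funD => //; exact: measurable_tnth.
Qed.

(** Induction on the dimension: the measure of a set is the integral of the lengths of its sections
    in the first coordinate. Length is invariant in dimension one, and the integral over the other
    coordinates is invariant by induction. *)
Lemma lebesgue_tuple_shift (N : nat) (v : 'I_N -> R) (A : set (N.-tuple mR)) :
  measurable A ->
  lebesgue_tuple N (tuple_shift v @^-1` A) = lebesgue_tuple N A.
Proof.
elim: N v A => [|N IH] v A mA.
  by congr (lebesgue_tuple 0 _); apply/seteqP; split => x /=;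
    rewrite (tuple0 (tuple_shift _ _)) (tuple0 x).
pose w i := v (lift ord0 i).
pose B := @cons_pair R N @^-1` A.
have mB : measurable B.
  by rewrite -[X in measurable X]setTI; exact: measurable_cons_pair.
have EA : (@cons_pair R N) @^-1` (tuple_shift v @^-1` A) =
    [set p | B (tuple_shift w p.1, p.2 + v ord0)].
  apply/seteqP; split => -[x r] /=; rewrite /B /= (_ : tuple_shift v _ =
     cons_pair (tuple_shift w x, r + v ord0)) //;
  apply: eq_from_tnth => i; rewrite /tuple_shift tnth_mktuple;
  by case: (unliftP ord0 i) => [j|] ->; rewrite ?tnthS ?tnth_mktuple.
rewrite /= /lebesgue_cons /pushforward EA -/B /product_measure1.
under eq_integral => x _.
  rewrite /= (_ : xsection _ x =
      (fun r : mR => r + v ord0) @^-1` (xsection B (tuple_shift w x))); last first.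
    by apply/seteqP; split => r; rewrite /xsection /= !inE.
  rewrite lebesgue_measure_shift; last exact: measurable_xsection.
  over.
apply: (ge0_integral_preserving (F := lebesgue_measure \o xsection B)).
- exact: measurable_tuple_shift.
- exact: IH.
- exact: measurable_fun_xsection.
- by move=> x; exact: measure_ge0.
Qed.

(** Measurability refers to the product sigma-algebra on tuples, openness to the topology of row
    vectors. They meet because an open set is a countable union of boxes with rational centres and
    radii 1/(k+1). *)
Lemma open_row_measurable (N : nat) (O : set 'rV[R]_N) :
  open O -> measurable (@row_of_tuple R N @^-1` O : set (N.-tuple mR)).
Proof.
move=> oO.
pose box (qk : N.-tuple rat * nat) : set (N.-tuple mR) :=
  [set x | forall i, (ball (ratr (tnth qk.1 i) : R) qk.2.+1%:R^-1) (tnth x i)].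
rewrite (_ : _ @^-1` _ =
    \bigcup_qk (if `[< box qk `<=` @row_of_tuple R N @^-1` O >] then box qk else set0)).
  apply: countable_bigcupT_measurable => // qk; case: ifPn => // _.
  apply: (measurable_box (A := fun i => ball (ratr (tnth qk.1 i) : R) qk.2.+1%:R^-1)) => i.
  exact: measurable_ball.
apply/seteqP; split => [x Ox|x [qk _]]; last by case: ifPn => // /asboolP; exact.
have /nbhs_ballP[e /= e0 xeO] : nbhs (row_of_tuple x) O by exact: open_nbhs_nbhs.
(* A box of radius below e / 2 that contains [x] stays in the ball of radius e about [x]. *)
have [k ke] : exists k : nat, k.+1%:R^-1 < e / 2.
  have e20 : 0 < e / 2 by exact: divr_gt0.
  by have [k _ /(_ k (leqnn k))] := near_infty_natSinv_lt (PosNum e20); exists k.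
have k0 : 0 < k.+1%:R^-1 :> R by rewrite invr_gt0.
have qx i : exists q : rat, `|tnth x i - ratr q| < k.+1%:R^-1.
  have [q] := @rat_in_itvoo R (tnth x i - k.+1%:R^-1) (tnth x i + k.+1%:R^-1)
    ltac:(by rewrite ltrD2l gtrN).
  by rewrite in_itv/= -ltr_distlC distrC; exists q; rewrite distrC.
pose q := [tuple sval (cid (qx i)) | i < N].
have qE i : `|ratr (tnth q i) - tnth x i| < k.+1%:R^-1.
  by rewrite tnth_mktuple distrC; case: cid.
exists (q, k) => //; case: ifPn => [_ i|/asboolP[]]; first exact: qE.
move=> y /= qy; apply: xeO; split => // a i; rewrite !mxE.
rewrite /ball/= (le_lt_trans (ler_distD (ratr (tnth q i)) _ _))//.
rewrite [ltRHS]splitr ltrD//; apply: lt_trans ke; last exact: qy.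
by rewrite distrC; exact: qE.
Qed.

Lemma continuous_row_measurable (N : nat) (g : 'rV[R]_N -> R) :
  continuous g -> measurable_fun setT (fun x : N.-tuple mR => g (row_of_tuple x)).
Proof.
move=> /continuousP cg; apply: (measurability _ (RGenOpens.measurableE R)).
move=> _ [_ [a [b ->] <-]]; rewrite setTI.
apply: (@open_row_measurable N (g @^-1` `]a, b[%classic)).
exact/cg/interval_open.
Qed.

(* Adding the parameter [t] as a coordinate reduces joint measurability to the
   previous lemma. *)
Lemma continuous_prod_row_measurable (N : nat) (g : R * 'rV[R]_N -> R) :
  continuous g ->
  measurable_fun setT (fun p : mR * N.-tuple mR => g (p.1, row_of_tuple p.2)).
Proof.
move=> cg.
pose h (v : 'rV[R]_N.+1) := g (v ord0 ord0, \row_j v ord0 (lift ord0 j)).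
have ch : continuous h.
  move=> v; apply: (@continuous_comp _ _ _
    (fun v : 'rV[R]_N.+1 => (v ord0 ord0, \row_j v ord0 (lift ord0 j)))); last exact: cg.
  apply: (@cvg_pair _ _ _ (nbhs v) (nbhs (v ord0 ord0))
      (nbhs (\row_j v ord0 (lift ord0 j))) _ _ _); first exact: coord_continuous.
  apply: cvg_row => j; rewrite mxE.
  rewrite (_ : (fun x => _) = (fun x : 'rV[R]_N.+1 => x ord0 (lift ord0 j))).
    exact: coord_continuous.
  by apply/funext => x; rewrite mxE.
have mc : measurable_fun setT (fun p : mR * N.-tuple mR => [tuple of p.1 :: p.2]).
  exact: (measurable_cons measurable_fst measurable_snd).
have := measurableT_comp (continuous_row_measurable ch) mc.
apply: eq_measurable_fun => -[t x] _ /=.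
rewrite /h !mxE /=; congr (g (_, _)).
by apply/rowP => j; rewrite !mxE tnthS.
Qed.

End lebesgue_tuple_theory.

(** * Goursat's bisection argument *)

(** The supremum of the left ends lies in every segment, because each left end is below each right
    end: compare both at the larger index. *)
Lemma nested_segments (R : realType) (u d : nat -> R) :
  (forall n, 0 <= d n) -> (forall n, u n <= u n.+1) ->
  (forall n, u n.+1 + d n.+1 <= u n + d n) ->
  exists p, forall n, u n <= p <= u n + d n.
Proof.
move=> d0 u_nd ud_ni.
have {}u_nd : {homo u : m n / (m <= n)%N >-> m <= n} by exact/nondecreasing_seqP.
have {}ud_ni : {homo (fun n => u n + d n) : m n / (m <= n)%N >-> n <= m}.
  by apply/nonincreasing_seqP.
have uud n m : u n <= u m + d m.
  apply: (le_trans (u_nd _ _ (leq_maxl n m))).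
  by apply: le_trans (ud_ni _ _ (leq_maxr n m)); rewrite lerDl.
exists (sup (range u)) => n; apply/andP; split.
  by apply: ub_le_sup; [exists (u 0 + d 0) => _ [m _ <-]|exists n].
by apply: ge_sup; [exists (u 0); exists 0|move=> _ [m _ <-]].
Qed.

Section goursat.
Context {R : realType}.
Implicit Types (s t l : R).

(* [B s t l] is a property of the square with lower left corner [(s, t)] and
   side [l]. *)
Lemma nested_squares (B : R -> R -> R -> Prop) :
  (forall s t l, 0 < l -> B s t l -> exists s' t',
     [/\ s' = s \/ s' = s + l / 2, t' = t \/ t' = t + l / 2 & B s' t' (l / 2)]) ->
  forall s t l, 0 < l -> B s t l -> exists p q,
    [/\ s <= p <= s + l, t <= q <= t + l & forall e, 0 < e ->
     exists s' t' l', [/\ 0 < l' < e, s' <= p <= s' + l', t' <= q <= t' + l' &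
       B s' t' l']].
Proof.
move=> step s t l l0 Bstl.
pose good (a b : R * R * R) := [/\ a.1.1 <= b.1.1, b.1.1 + b.2 <= a.1.1 + a.2,
  a.1.2 <= b.1.2, b.1.2 + b.2 <= a.1.2 + a.2 & b.2 = a.2 / 2 /\ B b.1.1 b.1.2 b.2].
(* A classical choice; [nextP] shows that a good square exists, so that the default value does not
   matter, as long as [B] holds on [a]. *)
pose next a := xget a (good a).
pose x n := iter n next (s, t, l).
have nextP a : 0 < a.2 -> B a.1.1 a.1.2 a.2 -> good a (next a).
  case: a => [[s1 t1] l1] /= l10 /(step _ _ _ l10)[s2 [t2 [s12 t12 B2]]].
  apply: (@xgetPex _ _ (good _)); exists (s2, t2, l1 / 2).
  by split => //=; [case: s12|case: s12|case: t12|case: t12] => ->; lra.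
have xP n : [/\ (x n).2 = l / 2 ^+ n, 0 < (x n).2, B (x n).1.1 (x n).1.2 (x n).2
    & good (x n) (x n.+1)].
  elim: n => [|n [xl xn0 Bx [_ _ _ _ [xS BxS]]]].
    by rewrite expr0 divr1; split => //; exact: nextP.
  have ? : 0 < (x n.+1).2 by rewrite xS divr_gt0.
  split => //; last exact: nextP.
  by rewrite xS xl exprSr invfM mulrA.
have x20 n : 0 <= (x n).2 by case: (xP n) => _ /ltW.
have [p pP] : exists p, forall n, (x n).1.1 <= p <= (x n).1.1 + (x n).2.
  by apply: nested_segments => // n; case: (xP n) => _ _ _ [].
have [q qP] : exists q, forall n, (x n).1.2 <= q <= (x n).1.2 + (x n).2.
  by apply: nested_segments => // n; case: (xP n) => _ _ _ [].
exists p, q; split; [exact: (pP 0)|exact: (qP 0)|move=> e e0].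
have [n ne] : exists n, l / 2 ^+ n < e.
  have [n _ /(_ n (leqnn n)) ln] := near_infty_natSinv_expn_lt (PosNum (divr_gt0 e0 l0)).
  by exists n; rewrite mulrC -ltr_pdivlMr// -[X in X < _]mul1r.
exists (x n).1.1, (x n).1.2, (x n).2; have [xl xn0 Bx _] := xP n.
by split => //; rewrite xn0 xl.
Qed.

Local Notation mu := (@lebesgue_measure R).

Lemma continuous_oc_integrable (f : R -> R) a b : continuous f ->
  mu.-integrable `]a, b] (EFin \o f).
Proof.
move=> cf; apply: (@integrableS _ _ _ mu `[a, b]%classic) => //.
  by apply: subset_itvr; rewrite bnd_simp.
apply: continuous_compact_integrable; first exact: segment_compact.
exact: continuous_subspaceT.
Qed.

Lemma Rintegral_oc_split (f : R -> R) a b c : continuous f -> a <= b -> b <= c ->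
  \int[mu]_(x in `]a, c]) f x = \int[mu]_(x in `]a, b]) f x + \int[mu]_(x in `]b, c]) f x.
Proof.
move=> cf ab bc; rewrite -(@Rintegral_itvB _ f (BRight a) (BRight c) b) ?bnd_simp//.
  by rewrite addrC subrK.
exact: continuous_oc_integrable.
Qed.

Lemma Rintegral_oc_cst a b (c : R) : a <= b ->
  \int[mu]_(x in `]a, b]) c = c * (b - a).
Proof.
move=> ab; rewrite Rintegral_cst//= lebesgue_measure_itv/= lte_fin.
by case: ltP => //= ba; rewrite (@le_anti _ _ a b) ?ab// subrr.
Qed.

Lemma Rintegral_oc_approx (f : R -> R) a b c e : continuous f -> a <= b ->
  (forall x, a < x <= b -> `|f x - c| <= e) ->
  `|\int[mu]_(x in `]a, b]) f x - c * (b - a)| <= e * (b - a).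
Proof.
move=> cf ab fce.
have cfc : continuous (fun x => f x - c).
  by move=> x; apply: cvgB; [exact: cf|exact: cvg_cst].
rewrite -!Rintegral_oc_cst// -RintegralB//; try exact: continuous_oc_integrable;
  last by apply: continuous_oc_integrable => x; exact: cvg_cst.
apply: le_trans (le_normr_Rintegral _ _) _ => //; first exact: continuous_oc_integrable.
apply: le_Rintegral => //.
- apply: (continuous_oc_integrable (f := fun x => `|f x - c|)) => x.
  by apply: cvg_norm; exact: cfc.
- by apply: continuous_oc_integrable => x; exact: cvg_cst.
Qed.


Lemma diff_approx (K : numFieldType) (V W : normedModType K) (f : V -> W) (p : V) :
  differentiable f p -> forall e, 0 < e -> exists2 r, 0 < r &
  forall x, `|x - p| < r -> `|f x - (f p + 'd f p (x - p))| <= e * `|x - p|.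
Proof.
move=> /diff_locally/eqaddoP fp e e0.
have /nbhs_norm0P[r r0 rP] := fp e e0; exists r => // x xp.
by rewrite -[in f x](subrK p x); exact: rP.
Qed.

Lemma linear_prodE (f : {linear (R^o * R^o)%type -> R^o}) (h : R * R) :
  f h = h.1 * f (1, 0) + h.2 * f (0, 1).
Proof.
have {1}-> : h = h.1 *: (1, 0) + h.2 *: (0, 1).
  by case: h => x y; congr (_, _); rewrite /= /GRing.scale/= !(mulr0, mulr1, addr0, add0r).
by rewrite linearD !linearZ.
Qed.

Lemma prod_norm_le (x y p q l : R) : `|x - p| <= l -> `|y - q| <= l ->
  `|(x, y) - (p, q)| <= l.
Proof. by move=> xp yq; rewrite prod_normE/= ge_max xp yq. Qed.

Definition circulation (P Q : R * R -> R) s t l : R :=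
  \int[mu]_(x in `]s, s + l]) P (x, t + l) - \int[mu]_(x in `]s, s + l]) P (x, t)
  + (\int[mu]_(y in `]t, t + l]) Q (s + l, y) - \int[mu]_(y in `]t, t + l]) Q (s, y)).

Lemma continuous_fst_slice (P : R * R -> R) t : continuous P ->
  continuous (fun x => P (x, t)).
Proof.
move=> cP x; apply: (@continuous_comp _ _ _ (fun x : R => (x, t)) P); last exact: cP.
by apply: (@cvg_pair _ _ _ _ (nbhs x) (nbhs t)); [exact: cvg_id|exact: cvg_cst].
Qed.

Lemma continuous_snd_slice (P : R * R -> R) s : continuous P ->
  continuous (fun y => P (s, y)).
Proof.
move=> cP y; apply: (@continuous_comp _ _ _ (fun y : R => (s, y)) P); last exact: cP.
by apply: (@cvg_pair _ _ _ _ (nbhs s) (nbhs y)); [exact: cvg_cst|exact: cvg_id].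
Qed.

(** Each inner edge belongs to two quarters and enters them with opposite signs. *)
Lemma circulation_quarters (P Q : R * R -> R) s t l : continuous P -> continuous Q ->
  0 <= l -> circulation P Q s t (l + l) =
  circulation P Q s t l + circulation P Q (s + l) t l +
  circulation P Q s (t + l) l + circulation P Q (s + l) (t + l) l.
Proof.
move=> cP cQ l0; rewrite /circulation.
have sp (f : R -> R) a : continuous f -> \int[mu]_(x in `]a, a + (l + l)]) f x =
    \int[mu]_(x in `]a, a + l]) f x + \int[mu]_(x in `]a + l, a + l + l]) f x.
  by move=> cf; rewrite addrA -Rintegral_oc_split ?lerDl.
rewrite !sp; try exact: continuous_fst_slice; try exact: continuous_snd_slice.
rewrite !addrA; ring.
Qed.

(** For affine [P] and [Q] the circulation is exactly the divergence times the area. The first-order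
    expansions at [p] have error o(l) on the square, hence o(l^2) after integration over sides of
    length l. *)
Lemma circulation_approx (P Q : R * R -> R) (p : R * R) :
  continuous P -> continuous Q ->
  differentiable P p -> differentiable Q p ->
  forall e, 0 < e -> exists2 r, 0 < r & forall s t l, 0 < l < r ->
    s <= p.1 <= s + l -> t <= p.2 <= t + l ->
    `|circulation P Q s t l - ('d P p (0, 1) + 'd Q p (1, 0)) * (l * l)| <= e * (l * l).
Proof.
(* Each of the four sides will contribute an error of at most e / 4 times the area. *)
move: p => [p q] cP cQ dP dQ e e0; have e40 : 0 < e / 4 by exact: divr_gt0.
have [r1 r10 Pr] := diff_approx dP e40.
have [r2 r20 Qr] := diff_approx dQ e40.
exists (Num.min r1 r2) => [|s t l]; first by rewrite lt_min r10.
rewrite lt_min /= => /and3P[l0 lr1 lr2] sp tq.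
have near x y (f : R * R -> R) r : differentiable f (p, q) ->
    (forall z, `|z - (p, q)| < r ->
      `|f z - (f (p, q) + 'd f (p, q) (z - (p, q)))| <= e / 4 * `|z - (p, q)|) ->
    l < r -> s <= x <= s + l -> t <= y <= t + l ->
    `|f (x, y) - (f (p, q) + (x - p) * 'd f (p, q) (1, 0) +
        (y - q) * 'd f (p, q) (0, 1))| <= e / 4 * l.
  move=> df fr lr sx ty.
  have xyl : `|(x, y) - (p, q)| <= l.
    by apply: prod_norm_le; rewrite ler_norml; apply/andP; split; lra.
  have := fr _ (le_lt_trans xyl lr); rewrite linear_prodE addrA => h.
  by apply: (le_trans h); rewrite ler_wpM2l// ltW.
have l0' := ltW l0.
have diff2 (u v u' v' d : R) : `|u - v| <= d -> `|u' - v'| <= d ->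
    `|u - u' - (v - v')| <= d + d.
  by rewrite !ler_norml => /andP[? ?] /andP[? ?]; apply/andP; split; lra.
(* Opposite sides are subtracted before integrating, so that the constant term and the derivative
   along the side cancel. *)
have hP : `|\int[mu]_(x in `]s, s + l]) (P (x, t + l) - P (x, t)) -
    ('d P (p, q) (0, 1) * l) * (s + l - s)| <= e / 2 * l * (s + l - s).
  apply: Rintegral_oc_approx; last move=> x /andP[/ltW sx xs]; last 2 first.
  - by rewrite lerDl.
  - have := diff2 _ _ _ _ _ (near x (t + l) P r1 dP Pr lr1 _ _) (near x t P r1 dP Pr lr1 _ _).
    rewrite sx xs !lexx lerDl l0' => /(_ isT isT isT isT).
    by congr (`|_| <= _); lra.
  by move=> x; apply: cvgB; exact: continuous_fst_slice.
have hQ : `|\int[mu]_(y in `]t, t + l]) (Q (s + l, y) - Q (s, y)) -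
    ('d Q (p, q) (1, 0) * l) * (t + l - t)| <= e / 2 * l * (t + l - t).
  apply: Rintegral_oc_approx; last move=> y /andP[/ltW ty yt]; last 2 first.
  - by rewrite lerDl.
  - have := diff2 _ _ _ _ _ (near (s + l) y Q r2 dQ Qr lr2 _ _) (near s y Q r2 dQ Qr lr2 _ _).
    rewrite ty yt !lexx lerDl l0' => /(_ isT isT isT isT).
    by congr (`|_| <= _); lra.
  by move=> y; apply: cvgB; exact: continuous_snd_slice.
move: hP hQ; rewrite /circulation !RintegralB//; try by
  apply: continuous_oc_integrable; (exact: continuous_fst_slice || exact: continuous_snd_slice).
rewrite !ler_norml => /andP[? ?] /andP[? ?]; apply/andP; split; lra.
Qed.

Local Open Scope ereal_scope.

Definition square s t l : set (measurableTypeR R * measurableTypeR R) :=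
  `]s, (s + l)%R] `*` `]t, (t + l)%R].

Lemma measurable_square s t l : measurable (square s t l).
Proof. by apply: measurableX; exact: measurable_itv. Qed.

Lemma product_lebesgue_square s t l : (0 < l)%R ->
  (mu \x mu) (square s t l) = (l * l)%:E.
Proof.
move=> l0; rewrite /square product_measure1E; try exact: measurable_itv.
by rewrite /= !lebesgue_measure_itv/= !lte_fin !ltrDl l0 -!EFinD -EFinM !(addrC _ l) !addrK.
Qed.

Lemma integral_square_quarters (W : R * R -> \bar R) s t l :
  measurable_fun setT (W : measurableTypeR R * measurableTypeR R -> _) ->
  (forall p, 0 <= W p) -> (0 < l)%R ->
  \int[mu \x mu]_(p in square s t (l + l)) W p =
  \int[mu \x mu]_(p in square s t l) W p +
  \int[mu \x mu]_(p in square (s + l) t l) W p +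
  \int[mu \x mu]_(p in square s (t + l) l) W p +
  \int[mu \x mu]_(p in square (s + l) (t + l) l) W p.
Proof.
move=> mW W0 l0.
have itvU (a : R) : (`]a, (a + (l + l))%R] = `]a, (a + l)%R] `|` `](a + l)%R, (a + l + l)%R])%classic.
  by rewrite addrA -itv_bndbnd_setU// bnd_simp lerDl ltW.
have dj (a : R) : (`]a, (a + l)%R] `&` `](a + l)%R, (a + l + l)%R] = set0)%classic.
  rewrite -subset0 => x [/=]; rewrite !in_itv/= => /andP[_ xa] /andP[ax _].
  by move: (lt_le_trans ax xa); rewrite ltxx.
have -> : square s t (l + l) = (square s t l `|` square (s + l) t l) `|`
    (square s (t + l) l `|` square (s + l) (t + l) l).
  by rewrite /square !itvU; apply/seteqP; split => -[x y] /=; tauto.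
have mS := measurable_square.
have disj0 (A B : set (R * R)) : (forall x, A x -> B x -> False) -> [disjoint A & B].
  by move=> AB; apply/disj_setPS => x [] /AB.
have djP (a x : R) : (`]a, (a + l)%R] x -> `](a + l)%R, (a + l + l)%R] x -> False)%classic.
  by move=> xa xal; rewrite -[False]/((set0 : set R) x) -(dj a).
rewrite !ge0_integral_setU => //; try exact: measurableU; try by move=> ? _; exact: W0.
all: try (apply: measurable_funS mW => //; do ?apply: measurableU).
- by rewrite addeA.
- by apply: disj0 => -[x y] [x1 _] [x2 _]; exact: (djP _ _ x1 x2).
- by apply: disj0 => -[x y] [x1 _] [x2 _]; exact: (djP _ _ x1 x2).
- by apply: disj0 => -[x y] [] [_ y1] [] [_ y2]; exact: (djP _ _ y1 y2).
Qed.

(** Goursat's argument. If the bound failed by a fixed amount per unit area, it would fail by the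
    same rate on some quarter, hence on squares shrinking to a point. There the circulation is
    nearly the divergence times the area, and the integral of [W] is nearly [W] times the area,
    which contradicts the pointwise bound. *)
Lemma circulation_le (P Q W : R * R -> R) s t l :
  continuous P -> continuous Q -> continuous W ->
  measurable_fun setT (W : measurableTypeR R * measurableTypeR R -> _) ->
  (forall p, 0 <= W p)%R -> (0 < l)%R ->
  (forall p, (s <= p.1 <= s + l)%R -> (t <= p.2 <= t + l)%R ->
    [/\ differentiable P p, differentiable Q p &
     `|'d P p (0, 1) + 'd Q p (1, 0)| <= W p]%R) ->
  `|circulation P Q s t l|%:E <= \int[mu \x mu]_(p in square s t l) (W p)%:E.
Proof.
move=> cP cQ cW mW W0 l0 dPQ.
apply/lee_addgt0Pr => e0 e00.
(* The excess per unit area, so that the allowed excess is additive over the four quarters. *)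
pose e := (e0 / (l * l))%R; have e_gt0 : (0 < e)%R by rewrite divr_gt0// mulr_gt0.
have -> : e0 = (e * (l * l))%R by rewrite divfK// mulf_neq0// gt_eqF.
rewrite leNgt; apply/negP => bad0.
have mEW : measurable_fun setT (fun p : measurableTypeR R * measurableTypeR R => (W p)%:E).
  exact/measurable_EFinP.
pose nu a b d := \int[mu \x mu]_(p in square a b d) (W p)%:E.
pose bad a b d := [/\ (s <= a)%R, (a + d <= s + l)%R, (t <= b)%R, (b + d <= t + l)%R &
  nu a b d + (e * (d * d))%:E < `|circulation P Q a b d|%:E].
have step a b d0 : (0 < d0)%R -> bad a b d0 -> exists a' b',
    [/\ a' = a \/ a' = (a + d0 / 2)%R, b' = b \/ b' = (b + d0 / 2)%R & bad a' b' (d0 / 2)%R].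
  move=> d00 [sa ad tb bd]; pose d := (d0 / 2)%R.
  have d_gt0 : (0 < d)%R by rewrite divr_gt0.
  have dE : d0 = (d + d)%R by rewrite -splitr.
  rewrite dE in ad bd *.
  rewrite /nu integral_square_quarters//= circulation_quarters ?(ltW d_gt0)//.
  rewrite -/(nu a b d) -/(nu (a + d) b d)%R -/(nu a (b + d) d)%R -/(nu (a + d) (b + d) d)%R.
  rewrite -dE -/d.
  rewrite {1 2}dE => sum_bad; apply: contrapT => nbad.
  have good a' b' : (a' = a \/ a' = a + d)%R -> (b' = b \/ b' = b + d)%R ->
      `|circulation P Q a' b' d|%:E <= nu a' b' d + (e * (d * d))%:E.
    move=> aa' bb'; rewrite leNgt; apply/negP => h; apply: nbad; exists a', b'.
    split => //; split => //.
    + by case: aa' => -> //; lra.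
    + by case: aa' => ->; lra.
    + by case: bb' => -> //; lra.
    + by case: bb' => ->; lra.
  move: sum_bad; rewrite ltNge => /negP; apply.
  have g1 := good _ _ (or_introl erefl) (or_introl erefl).
  have g2 := good _ _ (or_intror erefl) (or_introl erefl).
  have g3 := good _ _ (or_introl erefl) (or_intror erefl).
  have g4 := good _ _ (or_intror erefl) (or_intror erefl).
  have := leeD (leeD (leeD g1 g2) g3) g4; rewrite -!EFinD.
  have -> : (e * ((d + d) * (d + d)) = e * (d * d) + e * (d * d) + e * (d * d) + e * (d * d))%R by ring.
  move=> h; apply: le_trans (le_trans _ h) _.
    by rewrite lee_fin; do 3 (apply: le_trans (ler_normD _ _) _; rewrite lerD2r).
  by rewrite (addeACA (nu a b d)) (addeACA (nu a b d + _)) (addeACA (nu a b d + _ + _)) !EFinD.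
have [p [q [sp tq pq]]] : exists p q, _ :=
  nested_squares step l0 (And5 (lexx s) (lexx _) (lexx t) (lexx _) bad0).
have [dP dQ DW] := dPQ (p, q) sp tq.
have e40 : (0 < e / 4)%R by exact: divr_gt0.
have [r1 r10 Hr1] := circulation_approx cP cQ dP dQ e40.
have /cvgrPdist_le/(_ (e / 4)%R e40) := cW (p, q).
move=> /nbhs_normP[r2 /= r20 Hr2].
have [a [b [d [/andP[d0 dr] ap bq [_ _ _ _ bad_d]]]]] := pq (Num.min r1 r2) ltac:(by rewrite lt_min r10).
move: dr; rewrite lt_min => /andP[dr1 dr2].
have d00 := ltW d0.
have nu_ge : ((W (p, q) - e / 4) * (d * d))%:E <= nu a b d.
  (* The constant [W (p, q) - e / 4] may be negative; its positive part allows the comparison of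
     nonnegative integrals. *)
  apply: (@le_trans _ _ (\int[mu \x mu]_(x in square a b d) (Num.max 0 (W (p, q) - e / 4))%:E)).
    rewrite integral_cst//; last exact: measurable_square.
    rewrite [X in _ <= _ * X](_ : _ = (d * d)%:E); last exact: product_lebesgue_square.
    by rewrite -EFinM lee_fin ler_wpM2r ?mulr_ge0// le_max lexx orbT.
  apply: ge0_le_integral => //; first exact: measurable_square.
  + by move=> x _; rewrite lee_fin le_max lexx.
  + by apply: measurable_funS mEW.
  move=> [x y] [/=]; rewrite !in_itv/= => /andP[ax xa] /andP[by1 yb].
  rewrite lee_fin ge_max W0/= lerBlDr addrC -lerBlDr.
  apply: le_trans (ler_norm _) _; apply: Hr2 => /=.
  by apply: le_lt_trans dr2; rewrite distrC; apply: prod_norm_le;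
    rewrite ler_norml; apply/andP; split; lra.
have := Hr1 a b d ltac:(by rewrite d0) ap bq.
move=> hc; move: bad_d; rewrite ltNge => /negP; apply.
(* Two errors of rate e / 4, from the circulation and from [W], stay below the assumed excess of
   rate e. *)
apply: (le_trans _ (leeD nu_ge (lexx _))); rewrite -EFinD lee_fin.
have dd0 : (0 <= d * d)%R by exact: mulr_ge0.
have := ler_wpM2r dd0 DW; move: hc.
set D := ('d P _ _ + _)%R => hc hD.
have h1 : (`|circulation P Q a b d| <= `|D| * (d * d) + e / 4 * (d * d))%R.
  rewrite -[in leLHS](subrK (D * (d * d))%R (circulation P Q a b d)) addrC.
  by rewrite (le_trans (ler_normD _ _))// normrM [`|d * d|%R]ger0_norm// lerD2l.
have h2 : (0 <= e * (d * d))%R by rewrite mulr_ge0// ltW.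
clear -hD h1 h2; lra.
Qed.

End goursat.

(** * Integration over a measure-preserving flow *)

(** Bundles the product measure with its sigma-finiteness, so that plane measure can itself be one
    factor in Tonelli's theorem. *)
Definition sigma_finite_product d1 d2 (T1 : measurableType d1)
    (T2 : measurableType d2) (R : realType)
    (m1 : {sigma_finite_measure set T1 -> \bar R})
    (m2 : {sigma_finite_measure set T2 -> \bar R}) :
    {sigma_finite_measure set (T1 * T2)%type -> \bar R} :=
  HB.pack (m1 \x m2)%E
    (lebesgue_integral_fubini.measure_function_Measure_isSigmaFinite__to__measure_function_isSigmaFinite m1 m2)
    (lebesgue_integral_fubini.measure_function_Measure_isSigmaFinite__to__measure_function_isSFinite m1 m2).

Section fubini_on_set.
Local Open Scope ereal_scope.
Context d1 d2 (T : measurableType d1) (S : measurableType d2) (R : realType).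
Variable mu : {sigma_finite_measure set T -> \bar R}.
Variable nu : {sigma_finite_measure set S -> \bar R}.
Variables (B : set S) (mB : measurable B).

(** Extension by zero outside [B], with the factors swapped: integrals over [B] become integrals
    over the whole product. *)
Let patched (G : S * T -> \bar R) : T * S -> \bar R :=
  (fun p => G (p.2, p.1)) \_ (snd @^-1` B : set (T * S)).

Let patchedE G x y : patched G (x, y) = ((fun y => G (y, x)) \_ B) y.
Proof. by []. Qed.

Let measurable_patched G : measurable_fun setT G -> measurable_fun setT (patched G).
Proof.
move=> mG; apply/(measurable_restrictT _ _).1 => //.
  by rewrite -[X in measurable X]setTI; exact: measurable_snd.
by apply: measurable_funTS; apply: measurableT_comp => //; exact: measurable_fun_pair.
Qed.

Let integral_patched_col G y : \int[mu]_x patched G (x, y) =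
  ((fun y => \int[mu]_x G (y, x)) \_ B) y.
Proof.
rewrite [RHS]/patch; case: ifPn => yB.
  by apply: eq_integral => x _; rewrite patchedE /patch yB.
by rewrite integral0_eq// => x _; rewrite patchedE /patch (negbTE yB).
Qed.

Lemma ge0_measurable_integral_on_set (G : S * T -> \bar R) :
  measurable_fun setT G -> (forall p, 0 <= G p) ->
  measurable_fun setT (fun x => \int[nu]_(y in B) G (y, x)).
Proof.
move=> mG G0.
have p0 p : 0 <= patched G p by rewrite /patched erestrict_ge0.
rewrite (_ : (fun x => _) = fubini_F nu (patched G)).
  exact: measurable_fun_fubini_tonelli_F (measurable_patched mG) p0.
apply/funext => x; exact: integral_mkcond.
Qed.

Lemma ge0_fubini_on_set (G : S * T -> \bar R) :
  measurable_fun setT G -> (forall p, 0 <= G p) ->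
  \int[mu]_x \int[nu]_(y in B) G (y, x) = \int[nu]_(y in B) \int[mu]_x G (y, x).
Proof.
move=> mG G0.
under eq_integral do rewrite integral_mkcond.
rewrite (fubini_tonelli (patched G) (measurable_patched mG)).
  by rewrite [RHS]integral_mkcond; apply: eq_integral => y _; exact: integral_patched_col.
by move=> p; rewrite /patched erestrict_ge0.
Qed.

(** L^1 bounds uniform over a parameter set of finite measure give integrability on the product, and
    Fubini's theorem applies. *)
Lemma fubini_on_set (G : S * T -> R) (C : R) : measurable_fun setT G ->
  nu B < +oo -> (forall y, B y -> \int[mu]_x `|G (y, x)|%:E <= C%:E) ->
  mu.-integrable setT (fun x => \int[nu]_(y in B) (G (y, x))%:E) /\
  \int[mu]_x \int[nu]_(y in B) (G (y, x))%:E =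
  \int[nu]_(y in B) \int[mu]_x (G (y, x))%:E.
Proof.
move=> mG Boo GC.
pose f := patched (EFin \o G).
have mf : measurable_fun setT f by apply: measurable_patched; exact/measurable_EFinP.
have intf : (mu \x nu).-integrable setT f.
  apply/integrable21ltyP => //.
  (* [C] may be negative when [B] is empty, hence the absolute value. *)
  apply: (@le_lt_trans _ _ (\int[nu]_(y in B) (`|C|%:E))); last first.
    by rewrite integral_cst// lte_mul_pinfty.
  rewrite [leRHS]integral_mkcond; apply: ge0_le_integral => //.
  - by move=> y _; apply: integral_ge0.
  - apply: (measurable_fun_fubini_tonelli_G (abse \o f)) => //.
      exact: measurableT_comp.
    by move=> p; exact: abse_ge0.
  - by apply/(measurable_restrictT _ _).1 => //.
  - move=> y _; rewrite [leRHS]/patch; case: ifPn => yB; last first.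
      by rewrite integral0_eq// => x _; rewrite /f patchedE /patch (negbTE yB) abse0.
    apply: (@le_trans _ _ C%:E); last by rewrite lee_fin ler_norm.
    apply: le_trans (GC y _); last by rewrite inE in yB.
    rewrite le_eqVlt; apply/orP; left; apply/eqP.
    by apply: eq_integral => x _; rewrite /f patchedE /patch yB.
split.
  have := integrable_fubini_F intf; apply: eq_integrable => // x _.
  by rewrite /fubini_F [RHS]integral_mkcond.
under eq_integral do rewrite integral_mkcond.
rewrite (Fubini intf).
by rewrite [RHS]integral_mkcond; apply: eq_integral => y _; exact: integral_patched_col.
Qed.

End fubini_on_set.

Lemma integral_preserving d (T : measurableType d) (R : realType)
    (mu : {measure set T -> \bar R}) (th : T -> T) (F : T -> \bar R) :
  measurable_fun setT th ->
  (forall A, measurable A -> mu (th @^-1` A) = mu A) ->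
  measurable_fun setT F ->
  (\int[mu]_x F (th x) = \int[mu]_x F x)%E.
Proof.
move=> mth muth mF; rewrite integralE [RHS]integralE; congr (_ - _)%E.
  rewrite funepos_comp; apply: (ge0_integral_preserving (F := F^\+%E) mth muth) => //.
  exact: measurable_funepos.
rewrite funeneg_comp; apply: (ge0_integral_preserving (F := F^\-%E) mth muth) => //.
exact: measurable_funeneg.
Qed.

Section flow.
Local Open Scope ereal_scope.
Context d (T : measurableType d) (R : realType).
Variable mu : {sigma_finite_measure set T -> \bar R}.
Local Notation la := (@lebesgue_measure R).
Local Notation mR := (measurableTypeR R).

Variable th : R -> T -> T.
Hypothesis mth : measurable_fun setT (fun p : mR * T => th p.1 p.2).
Hypothesis muth : forall s A, measurable A -> mu (th s @^-1` A) = mu A.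

Let mth_s s : measurable_fun setT (th s).
Proof.
exact: (measurableT_comp mth (pair1_measurable (s : mR))).
Qed.

Variables (P Q W : R * T -> R) (a b K C : R).
Hypothesis ab : (a < b)%R.
Hypothesis mP : measurable_fun setT (P : mR * T -> _).
Hypothesis mQ : measurable_fun setT (Q : mR * T -> _).
Hypothesis mW : measurable_fun setT (W : mR * T -> _).
Hypothesis W0 : forall p, (0 <= W p)%R.
Hypothesis PK : forall t, (a <= t <= b)%R -> \int[mu]_x `|P (t, x)|%:E <= K%:E.
Hypothesis QK : forall t, (a <= t <= b)%R -> \int[mu]_x `|Q (t, x)|%:E <= K%:E.
Hypothesis WC : forall t, (a <= t <= b)%R -> \int[mu]_x (W (t, x))%:E <= C%:E.

(** [G] seen from the orbit of [x] as a function on the plane: the flow parameter comes first, the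
    time second. *)
Let along (G : R * T -> R) (x : T) (p : R * R) : R := G (p.2, th p.1 x).

Hypothesis cP : forall x, continuous (along P x).
Hypothesis cQ : forall x, continuous (along Q x).
Hypothesis circW : forall x,
  `|circulation (along P x) (along Q x) 0 a (b - a)|%:E <=
  \int[la \x la]_(p in square 0 a (b - a)) (along W x p)%:E.

Let msection (G : R * T -> R) t : measurable_fun setT (G : mR * T -> _) ->
  measurable_fun setT (fun x => G (t, x)).
Proof.
move=> mG.
exact: (measurableT_comp mG (pair1_measurable (t : mR))).
Qed.

(** Integrate [circW] over [x]. The bound [K] justifies the exchanges of integrals along the four
    sides, while the resulting constant comes from [C] alone; a factor [L] is cancelled at the
    end. *)
Lemma flow_lipschitz :
  (`|\int[mu]_x P (b, x) - \int[mu]_x P (a, x)| <= C * (b - a))%R.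
Proof.
pose L := (b - a)%R; have L0 : (0 < L)%R by rewrite subr_gt0.
have Loc (c : R) : la `]c, (c + L)%R] = L%:E.
  by rewrite lebesgue_measure_itv/= lte_fin ltrDl L0 -EFinD addrAC subrr add0r.
have Locy (c : R) : la `]c, (c + L)%R] < +oo by rewrite Loc ltry.
have abt t : t \in `]a, (a + L)%R] -> (a <= t <= b)%R.
  by rewrite in_itv/= /L addrC subrK => /andP[/ltW -> ->].
have int_th (G : R * T -> R) s t : measurable_fun setT (G : mR * T -> _) ->
    \int[mu]_x (G (t, th s x))%:E = \int[mu]_x (G (t, x))%:E.
  move=> mG; apply: (integral_preserving (mth_s s) (muth s) (F := fun x => (G (t, x))%:E)).
  by apply/measurable_EFinP; exact: msection.
have abs_th (G : R * T -> R) s t : measurable_fun setT (G : mR * T -> _) ->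
    \int[mu]_x `|G (t, th s x)|%:E = \int[mu]_x `|G (t, x)|%:E.
  move=> mG; apply: (int_th (fun p => `|G p|%R)).
  exact: measurableT_comp.
(* Sides at fixed time: by invariance every flow parameter contributes the same integral, hence the
   factor [L]. *)
have hor t : (a <= t <= b)%R ->
    mu.-integrable setT (fun x => \int[la]_(s in `]0%R, (0 + L)%R]) (P (t, th s x))%:E) /\
    \int[mu]_x \int[la]_(s in `]0%R, (0 + L)%R]) (P (t, th s x))%:E =
    (\int[mu]_x P (t, x) * L)%:E.
  move=> tab.
  have mG := measurableT_comp mP (measurableT_comp (pair1_measurable (t : mR)) mth).
  have [s _|iG ->] := @fubini_on_set _ _ T mR R mu la _ (measurable_itv `]0%R, (0 + L)%R]) _ K mG (Locy 0%R).
    by rewrite /= abs_th//; exact: PK.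
  split => //; under eq_integral do rewrite int_th//.
  have intP : mu.-integrable setT (fun x => (P (t, x))%:E).
    apply/integrableP; split; first by apply/measurable_EFinP; exact: msection.
    by apply: le_lt_trans (PK tab) _; rewrite ltry.
  rewrite -[X in \int[_]_(_ in _) X]fineK; last exact: integrable_fin_num.
  rewrite integral_cst//.
  by rewrite [X in _ * X](_ : _ = L%:E) ?EFinM//; exact: Loc.
(* Sides at fixed flow parameter: the value does not depend on [s], so that the two sides cancel. *)
have ver s : mu.-integrable setT (fun x => \int[la]_(t in `]a, (a + L)%R]) (Q (t, th s x))%:E) /\
    \int[mu]_x \int[la]_(t in `]a, (a + L)%R]) (Q (t, th s x))%:E =
    \int[la]_(t in `]a, (a + L)%R]) \int[mu]_x (Q (t, x))%:E.
  have mG := measurableT_comp mQ (measurable_fun_pair measurable_fst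
      (measurableT_comp (mth_s s) measurable_snd)).
  have [t tab|iG ->] := @fubini_on_set _ _ T mR R mu la _ (measurable_itv `]a, (a + L)%R]) _ K mG (Locy a).
    by rewrite /= abs_th//; exact/QK/abt.
  by split => //; apply: eq_integral => t _; rewrite int_th.
have aLb : (a + L = b)%R by rewrite /L addrC subrK.
have [iPb EPb] := hor b ltac:(by rewrite (ltW ab) lexx).
have [iPa EPa] := hor a ltac:(by rewrite (ltW ab) lexx).
have [iQL EQL] := ver (0 + L)%R.
have [iQ0 EQ0] := ver 0%R.
have iPba := integrableB measurableT iPb iPa.
have iQL0 := integrableB measurableT iQL iQ0.
have iI := integrableD measurableT iPba iQL0.
have EI := integralD measurableT iPba iQL0.
rewrite (integralB measurableT iPb iPa) (integralB measurableT iQL iQ0) in EI.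
rewrite EPb EPa EQL EQ0 in EI.
(* Cancelling two equal terms in the extended reals requires them to be finite. *)
have J_fin : \int[la]_(t in `]a, (a + L)%R]) \int[mu]_x (Q (t, x))%:E \is a fin_num.
  by rewrite -EQL; exact: integrable_fin_num.
rewrite subee// adde0 -EFinB -mulrBl in EI.
have circE x : (circulation (along P x) (along Q x) 0 a L)%:E =
    \int[la]_(s in `]0%R, (0 + L)%R]) (P (b, th s x))%:E -
    \int[la]_(s in `]0%R, (0 + L)%R]) (P (a, th s x))%:E +
    (\int[la]_(t in `]a, (a + L)%R]) (Q (t, th (0 + L) x))%:E -
     \int[la]_(t in `]a, (a + L)%R]) (Q (t, th 0 x))%:E).
  have fin f c : continuous f -> (\int[la]_(x in `]c, (c + L)%R]) f x)%:E =
      \int[la]_(x in `]c, (c + L)%R]) (f x)%:E.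
    move=> cf; rewrite /Rintegral fineK//; apply: integrable_fin_num => //.
    exact: continuous_oc_integrable.
  rewrite /circulation EFinD !EFinB !fin ?aLb//;
    by [exact: continuous_fst_slice|exact: continuous_snd_slice].
have mI : measurable_fun setT (fun x => (circulation (along P x) (along Q x) 0 a L)%:E).
  by apply: eq_measurable_fun (measurable_int mu iI) => x _; rewrite -circE.
have mWth : measurable_fun setT (fun q : (mR * mR) * T => (along W q.2 q.1)%:E).
  apply/measurable_EFinP.
  apply: (measurableT_comp mW (measurable_fun_pair
    (measurableT_comp measurable_snd measurable_fst) _)).
  exact: (measurableT_comp mth (measurable_fun_pair
    (measurableT_comp measurable_fst measurable_fst) measurable_snd)).
have mS := measurable_square (0 : R) a L.
have LL0 : (0 < L * L)%R by rewrite mulr_gt0.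
have : `|\int[mu]_x (circulation (along P x) (along Q x) 0 a L)%:E| <= (C * (L * L))%:E.
  apply: le_trans (le_abse_integral mu measurableT mI) _.
  apply: (@le_trans _ _ (\int[mu]_x \int[la \x la]_(p in square 0 a L) (along W x p)%:E)).
    apply: ge0_le_integral => //.
    - exact: measurableT_comp.
    - have := ge0_measurable_integral_on_set (sigma_finite_product la la) mS mWth.
      apply.
      by move=> p; rewrite lee_fin W0.
    - by move=> x _; exact: circW.
  (* Tonelli puts the integral over the space inside, where invariance and [WC] bound it by [C] at
     each point of the square of area [L * L]. *)
  rewrite (ge0_fubini_on_set mu (sigma_finite_product la la) mS mWth).
    apply: (@le_trans _ _ (\int[la \x la]_(p in square 0 a L) C%:E)).
      apply: ge0_le_integral => //.
      - by move=> p _; apply: integral_ge0 => x _; rewrite lee_fin W0.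
      - by apply: measurable_funTS; apply: (measurable_fun_fubini_tonelli_F
          (m2 := mu) _ mWth) => p; rewrite lee_fin W0.
      - move=> [s t] [_ /=]; rewrite in_itv/= => tab.
        rewrite /along /= int_th//; apply: WC; exact: abt.
    rewrite integral_cst// EFinM.
    by rewrite [X in _ * X](_ : _ = (L * L)%:E)//; exact: product_lebesgue_square.
  by move=> p; rewrite lee_fin W0.
under eq_integral do rewrite circE.
rewrite EI abse_EFin lee_fin normrM (gtr0_norm L0) mulrA.
by rewrite ler_pM2r.
Qed.

End flow.

(** * Complex differentiability in real coordinates *)

Import ComplexField.Normc.
Local Open Scope complex_scope.

Section complex_norm.
Context {R : realType}.
Implicit Types z w : R[i].

Lemma normc_norm z : `|z| = (normc z)%:C.
Proof. by case: z => x y; rewrite normc_def. Qed.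

Lemma normRe_le z : `|complex.Re z| <= normc z.
Proof.
by case: z => x y /=; rewrite -sqrtr_sqr ler_sqrt ?lerDl ?addr_ge0 ?sqr_ge0.
Qed.

Lemma normIm_le z : `|complex.Im z| <= normc z.
Proof.
by case: z => x y /=; rewrite -sqrtr_sqr ler_sqrt ?lerDr ?addr_ge0 ?sqr_ge0.
Qed.

Lemma normc_le_ReIm z : normc z <= `|complex.Re z| + `|complex.Im z|.
Proof.
case: z => x y /=; rewrite -[leRHS]ger0_norm ?addr_ge0// -sqrtr_sqr.
rewrite ler_sqrt ?sqr_ge0// sqrrD !real_normK ?num_real//.
by rewrite lerD2r lerDl mulrn_wge0// mulr_ge0.
Qed.

Lemma cvg_complexP (I : Type) (F : set_system I) (f : I -> R[i]^o) (l : R[i]^o) :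
  Filter F -> f @ F --> l <->
  (complex.Re (f x) @[x --> F] --> complex.Re l) /\
  (complex.Im (f x) @[x --> F] --> complex.Im l).
Proof.
move=> FF; split=> [fl|[fRe fIm]].
  split; apply/cvgrPdist_le => e e0.
    have e0C : 0 < (e%:C : R[i]) by rewrite ltcR.
    have /cvgrPdist_le/(_ _ e0C) := fl; apply: filterS => x.
    rewrite normc_norm lecR; apply: le_trans.
    by case: (l) (f x) => ? ? [? ?]; exact: (normRe_le (_ +i* _)).
  have e0C : 0 < (e%:C : R[i]) by rewrite ltcR.
  have /cvgrPdist_le/(_ _ e0C) := fl; apply: filterS => x.
  rewrite normc_norm lecR; apply: le_trans.
  by case: (l) (f x) => ? ? [? ?]; exact: (normIm_le (_ +i* _)).
(* The norm of R[i] takes values in R[i]; a positive radius has imaginary part zero and is thus a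
   real number. *)
apply/cvgrPdist_le => -[e e']; rewrite ltcE /= => /andP[/eqP -> e0].
have e20 : 0 < e / 2 by exact: divr_gt0.
have /cvgrPdist_le/(_ _ e20) hRe := fRe.
have /cvgrPdist_le/(_ _ e20) hIm := fIm.
apply: filterS2 hRe hIm => x hRe hIm.
rewrite normc_norm -[_ +i* 0]/(e%:C) lecR (le_trans (normc_le_ReIm _))//.
by rewrite [leRHS]splitr lerD//; case: (l) (f x) hRe hIm => ? ? [? ?].
Qed.

Lemma continuous_complex (X : topologicalType) (f g : X -> R) :
  continuous f -> continuous g -> continuous (fun x => f x +i* g x : R[i]^o).
Proof.
by move=> cf cg x; apply/cvg_complexP; split; [exact: cf|exact: cg].
Qed.

End complex_norm.

Section differentiable_R2.
Context {R : realType}.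

Definition lin2 (a b : R) (h : R * R) : R := a * h.1 + b * h.2.

Lemma lin2_is_linear a b : linear (lin2 a b : R^o * R^o -> R^o).
Proof.
by move=> k [x y] [x' y']; rewrite /lin2 /= /GRing.scale/=; ring.
Qed.

HB.instance Definition _ a b :=
  GRing.isLinear.Build R (R^o * R^o)%type R^o _ (lin2 a b) (lin2_is_linear a b).

Lemma lin2_continuous a b : continuous (lin2 a b).
Proof.
move=> [x y]; apply: cvgD; apply: cvgM; try exact: cvg_cst.
  exact: cvg_fst.
exact: cvg_snd.
Qed.

(** A continuous linear map that approximates to first order is the differential, by uniqueness. *)
Lemma differentiable_lin2 (f : R * R -> R) (p : R * R) (a b : R) :
  (forall e, 0 < e -> exists2 r, 0 < r & forall q, `|q - p| < r ->
    `|f q - f p - lin2 a b (q - p)| <= e * `|q - p|) ->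
  differentiable f p /\ 'd f p = lin2 a b :> (R * R -> R).
Proof.
move=> fp.
have fo : f \o shift p = cst (f p) + (lin2 a b) +o_ (0 : R * R) id.
  apply/eqaddoP => e e0; have [r r0 rP] := fp e e0.
  apply: (@nbhs_norm0P R (R^o * R^o)%type _).2; exists r => // h /= hr.
  have := rP (h + p); rewrite addrK => /(_ hr).
  by rewrite -addrA -opprD.
have dE : 'd f p = lin2 a b :> (R * R -> R).
  apply: (diff_unique (df := lin2 a b : {linear (R^o * R^o)%type -> R^o})) => //.
  exact: lin2_continuous.
split => //; apply/diff_locallyP; rewrite dE; split => //.
exact: lin2_continuous.
Qed.

End differentiable_R2.

Section cauchy_riemann.
Context {R : realType}.

(** The differential is linear over R[i], so on the complex line through [q] in direction [v] it is
    multiplication by its value at [v]. The estimate is restated with real norms. *)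
Lemma complex_direction_approx (V : normedModType R[i]) (G : V -> R[i]^o) (q v : V) :
  differentiable G q -> exists c : R[i], forall e, 0 < e -> exists2 r, 0 < r &
  forall h : R * R, `|h| < r ->
  normc (G (q + (h.1 +i* h.2) *: v) - G q - c * (h.1 +i* h.2)) <= e * `|h|.
Proof.
move=> dG; exists ('d G q v) => e e0.
pose N := complex.Re `|v|.
have vE : `|v| = N%:C by rewrite RRe_real// ger0_real.
have N0 : 0 <= N by rewrite -lecR -vE; exact: normr_ge0.
(* The factor 2 compares the modulus with the maximum norm of the plane; adding 1 keeps the constant
   positive when [v] is zero. *)
have N10 : 0 < 2 * (N + 1) by rewrite mulr_gt0// ltr_wpDl.
have eK0 : 0 < (e / (2 * (N + 1)))%:C by rewrite ltcR divr_gt0.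
have [[r r'] r0 rP] := diff_approx dG eK0.
move: r0; rewrite ltcE/= => /andP[/eqP r'0 r0]; rewrite {}r'0 in rP.
have zh (h : R * R) : normc (h.1 +i* h.2) <= 2 * `|h|.
  apply: le_trans (normc_le_ReIm _) _ => /=; rewrite mulrDl mul1r lerD//.
    by rewrite prod_normE le_max lexx.
  by rewrite prod_normE le_max lexx orbT.
have zvh (h : R * R) : `|(h.1 +i* h.2) *: v| <= (2 * (N + 1) * `|h|)%:C.
  rewrite normrZ vE normc_norm -rmorphM lecR mulrAC ler_pM// ?lerDl//.
  exact: le_trans (normr_ge0 _) (normRe_le _).
exists (r / (2 * (N + 1))) => [|h]; first exact: divr_gt0.
rewrite ltr_pdivlMr// mulrC => hr.
have := rP (q + (h.1 +i* h.2) *: v); rewrite [q + _ - q]addrAC subrr add0r.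
rewrite -ltcR in hr; move=> /(_ (le_lt_trans (zvh h) hr)).
rewrite linearZ/= => H; rewrite -lecR -normc_norm.
rewrite -addrA -opprD -[c in c * _]/('d G q v) mulrC.
apply: le_trans H _; apply: le_trans (ler_wpM2l (ltW eK0) (zvh h)) _.
by rewrite -rmorphM lecR mulrA divfK ?gt_eqF.
Qed.

(** The Cauchy-Riemann equations: in real coordinates, multiplication by a + ib has the rows (a, -b)
    and (b, a). *)
Lemma complex_direction_diff (V : normedModType R[i]) (G : V -> R[i]^o) (q v : V)
    (s t : R) (F := fun p : R * R => G (q + ((p.1 - s) +i* (p.2 - t)) *: v)) :
  differentiable G q -> exists a b : R,
  [/\ differentiable (@complex.Re R \o F) (s, t),
      'd (@complex.Re R \o F) (s, t) = lin2 a (- b) :> (R * R -> R),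
      differentiable (@complex.Im R \o F) (s, t) &
      'd (@complex.Im R \o F) (s, t) = lin2 b a :> (R * R -> R)].
Proof.
move=> /(complex_direction_approx v)[[a b] Gq]; exists a, b.
have Fst : F (s, t) = G q by rewrite /F /= !subrr scale0r addr0.
have reim e : 0 < e -> exists2 r, 0 < r & forall p : R * R, `|p - (s, t)| < r ->
    normc (F p - F (s, t) - (a +i* b) * ((p.1 - s) +i* (p.2 - t))) <= e * `|p - (s, t)|.
  move=> e0; have [r r0 rP] := Gq e e0; exists r => // p pr.
  by have := rP _ pr; rewrite Fst.
have [dRe dRe'] := @differentiable_lin2 _ (@complex.Re R \o F) (s, t) a (- b) ltac:(
  move=> e e0; have [r r0 rP] := reim e e0; exists r => // p pr;
  apply: le_trans (rP p pr); apply: le_trans (normRe_le _);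
  rewrite /lin2 /=; case: (F p) (F (s, t)) => ? ? [? ?] /=; rewrite -?subrr mulNr; exact: lexx).
have [dIm dIm'] := @differentiable_lin2 _ (@complex.Im R \o F) (s, t) b a ltac:(
  move=> e e0; have [r r0 rP] := reim e e0; exists r => // p pr;
  apply: le_trans (rP p pr); apply: le_trans (normIm_le _);
  rewrite /lin2 /=; case: (F p) (F (s, t)) => ? ? [? ?] /=; rewrite [in leLHS](addrC (b * _)); exact: lexx).
by split.
Qed.

End cauchy_riemann.

(** * Differentials in the plane and the pairing with a test function *)

Section plane_differentials.
Context {R : realType}.
Implicit Types (f U V : R * R -> R) (z : R * R).

(** The differential depends only on the germ; this will replace functions by their truncations in
    time. *)
Lemma is_diff_lin2_near f g z a b :
  is_diff z f (lin2 a b) -> (\forall w \near z, f w = g w) -> is_diff z g (lin2 a b).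
Proof.
move=> dfz fg.
have fgz : f z = g z by exact: nbhs_singleton fg.
have /nbhs_normP[r1 /= r10 fg1] := fg.
have [] := @differentiable_lin2 _ g z a b; last by move=> ? ?; exact: DiffDef.
move=> e e0; have [r2 r20 fr] := diff_approx (ex_diff (f := f)) e0.
exists (Num.min r1 r2) => [|w]; first by rewrite lt_min r10.
rewrite lt_min => /andP[wr1 /fr]; rewrite diff_val opprD addrA fgz.
by rewrite fg1//= distrC.
Qed.

(** A test function does not depend on time, hence the coefficient 0; one directional derivative
    suffices for differentiability in the plane. *)
Lemma is_diff_lin2_shift (N : nat) (f : 'rV[R]_N -> R) (x e : 'rV[R]_N) (s t : R) :
  derivable f (x + s *: e) e ->
  is_diff (s, t) (fun p : R * R => f (x + p.1 *: e)) (lin2 ('D_e f (x + s *: e)) 0).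
Proof.
move=> df.
have [] := @differentiable_lin2 _ (fun p : R * R => f (x + p.1 *: e)) (s, t)
  ('D_e f (x + s *: e)) 0; last by move=> ? ?; exact: DiffDef.
move=> eps eps0; have /eqaddoP/(_ _ eps0) := derivable_nbhs df.
move=> /nbhs_norm0P[r r0 rP]; exists r => // -[s' t'] /=.
rewrite prod_normE /= gt_max => /andP[sr _].
have := rP (s' - s) sr; rewrite /lin2 /= mul0r addr0.
rewrite -[X in `|X| <= _ -> _]/(f ((s' - s) *: e + (x + s *: e)) -
   (f (x + s *: e) + (s' - s) *: 'D_e f (x + s *: e))).
rewrite addrCA -scalerDl subrK opprD addrA (mulrC ('D_e f _)) => h.
  apply: (le_trans h).
by rewrite ler_wpM2l ?(ltW eps0)// le_max lexx.
Qed.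

(** The two functions are the real and imaginary parts of (U + iV)(p + iq). By the Cauchy-Riemann
    equations the derivatives of [U] and [V] cancel, leaving the imaginary part of (U + iV)(p' +
    iq'): the derivative has moved onto the test function. *)
Lemma divergence_complex_product U V p q z a b p' q' :
  is_diff z U (lin2 a (- b)) -> is_diff z V (lin2 b a) ->
  is_diff z p (lin2 p' 0) -> is_diff z q (lin2 q' 0) ->
  [/\ differentiable (U * p - V * q) z, differentiable (U * q + V * p) z &
  'd (U * p - V * q) z (0, 1) + 'd (U * q + V * p) z (1, 0) = U z * q' + V z * p'].
Proof.
move=> dU dV dp dq; split=> //; rewrite !diff_val.
rewrite -[X in X + _]/(U z * lin2 p' 0 (0, 1) + p z * lin2 a (- b) (0, 1) -
  (V z * lin2 q' 0 (0, 1) + q z * lin2 b a (0, 1))).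
rewrite -[X in _ + X]/(U z * lin2 q' 0 (1, 0) + q z * lin2 a (- b) (1, 0) +
  (V z * lin2 p' 0 (1, 0) + p z * lin2 b a (1, 0))).
rewrite /lin2/=; ring.
Qed.

End plane_differentials.

(** A named copy of the measure, to which the sigma-finite structure is attached. *)
Definition lebesgue_tuple_measure (R : realType) (N : nat) :
  set (N.-tuple (measurableTypeR R)) -> \bar R := @lebesgue_tuple R N.

HB.instance Definition _ R N := Measure.on (@lebesgue_tuple_measure R N).

HB.instance Definition _ R N := Measure_isSigmaFinite.Build _ _ _
  (@lebesgue_tuple_measure R N) (@lebesgue_tuple_sigma_finite R N).

(** * Lipschitz dependence of the pairing on time *)

Section lipschitz.
Context {R : realType} {N : nat} (i : 'I_N).
Local Notation mR := (measurableTypeR R).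
Local Notation mu := (@lebesgue_tuple R N).
Local Notation e := (delta_mx 0 i : 'rV[R]_N).

Definition coord_shift (s : R) (x : N.-tuple mR) : N.-tuple mR :=
  tuple_shift (fun j => s * (i == j)%:R) x.

Lemma row_coord_shift s x :
  row_of_tuple (coord_shift s x) = row_of_tuple x + s *: e.
Proof.
by apply/rowP => j; rewrite !mxE tnth_mktuple eqxx [j == i]eq_sym.
Qed.

Lemma measurable_coord_shift :
  measurable_fun setT (fun p : mR * N.-tuple mR => coord_shift p.1 p.2).
Proof.
apply/measurable_fun_tnthP => j.
rewrite (_ : _ \o _ = (fun p => tnth p.2 j + p.1 * (i == j)%:R)); last first.
  by apply/funext => p /=; rewrite tnth_mktuple.
apply: measurable_funD.
  exact: (measurableT_comp (@measurable_tnth _ _ _ j) measurable_snd).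
by apply: measurable_funM => //; exact: measurable_fst.
Qed.

Variables (u v : R * 'rV[R]_N -> R) (M : R).
Hypothesis cu : forall z : R * 'rV[R]_N, 0 < z.1 -> {for z, continuous u}.
Hypothesis cv : forall z : R * 'rV[R]_N, 0 < z.1 -> {for z, continuous v}.
Hypothesis CR : forall (x : 'rV[R]_N) (s t : R), 0 < t -> exists a b : R,
  is_diff (s, t) (fun p : R * R => u (p.2, x + p.1 *: e)) (lin2 a (- b)) /\
  is_diff (s, t) (fun p : R * R => v (p.2, x + p.1 *: e)) (lin2 b a).
Hypothesis uM : forall t : R, 0 < t -> (\int[mu]_x `|u (t, row_of_tuple x)|%:E <= M%:E)%E.
Hypothesis vM : forall t : R, 0 < t -> (\int[mu]_x `|v (t, row_of_tuple x)|%:E <= M%:E)%E.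

Variables (p q : 'rV[R]_N -> R) (C0 C1 : R).
Hypotheses (cp : continuous p) (cq : continuous q).
Hypotheses (dp : forall x : 'rV[R]_N, derivable p x e) (dq : forall x : 'rV[R]_N, derivable q x e).
Hypotheses (pC0 : forall x : 'rV[R]_N, `|p x| <= C0) (qC0 : forall x : 'rV[R]_N, `|q x| <= C0).
Hypotheses (pC1 : forall x : 'rV[R]_N, `|'D_e p x| <= C1) (qC1 : forall x : 'rV[R]_N, `|'D_e q x| <= C1).

(* Truncating the time variable below makes [u] and [v] continuous everywhere. *)
Let trunc (d : R) (f : R * 'rV[R]_N -> R) (z : R * 'rV[R]_N) : R :=
  f (Num.max z.1 d, z.2).

Let trunc_continuous d f : 0 < d -> (forall z : R * 'rV[R]_N, 0 < z.1 -> {for z, continuous f}) ->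
  continuous (trunc d f).
Proof.
move=> d0 cf z.
apply: (@continuous_comp _ _ _ (fun z : R * 'rV[R]_N => (Num.max z.1 d, z.2)) f).
  apply: (@cvg_pair _ _ _ _ (nbhs (Num.max z.1 d)) (nbhs z.2)).
    by apply: continuous_max; [exact: cvg_fst|exact: cvg_cst].
  exact: cvg_snd.
by apply: cf => /=; rewrite lt_max d0 orbT.
Qed.

Let along_continuous (f : R * 'rV[R]_N -> R) (x : 'rV[R]_N) : continuous f ->
  continuous (fun z : R * R => f (z.2, x + z.1 *: e)).
Proof.
move=> cf z.
apply: (@continuous_comp _ _ _ (fun z : R * R => (z.2, x + z.1 *: e)) f); last exact: cf.
apply: (@cvg_pair _ _ _ _ (nbhs z.2) (nbhs (x + z.1 *: e))); first exact: cvg_snd.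
by apply: cvgD; [exact: cvg_cst|apply: cvgZr_tmp; exact: cvg_fst].
Qed.

Let continuous_weight (f : R * 'rV[R]_N -> R) (g : 'rV[R]_N -> R) :
  continuous f -> continuous g -> continuous (fun z => f z * g z.2).
Proof.
move=> cf cg z; apply: cvgM; first exact: cf.
by apply: (@continuous_comp _ _ _ snd g); [exact: cvg_snd|exact: cg].
Qed.

(** Apply [flow_lipschitz] to the translations along coordinate [i], with the real and imaginary
    parts of (u + iv)(p + iq) as P and Q. Their divergence is at most C1 (|u| + |v|), whose integral
    is at most C1 (M + M). *)
Lemma pairing_lipschitz (a b : R) : 0 < a -> a < b ->
  `|\int[mu]_x (u (b, row_of_tuple x) * p (row_of_tuple x) -
                 v (b, row_of_tuple x) * q (row_of_tuple x)) -
    \int[mu]_x (u (a, row_of_tuple x) * p (row_of_tuple x) -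
                 v (a, row_of_tuple x) * q (row_of_tuple x))|
  <= C1 * (M + M) * (b - a).
Proof.
(* Strictly below [a], so that the truncation changes nothing in a whole neighbourhood of each time
   in [a, b], the end [a] included. *)
move=> a0 ab; pose d := a / 2.
have d0 : 0 < d by exact: divr_gt0.
have C00 : 0 <= C0 by exact: le_trans (normr_ge0 _) (pC0 0).
have C10 : 0 <= C1 by exact: le_trans (normr_ge0 _) (pC1 0).
have cu' := trunc_continuous d0 cu; have cv' := trunc_continuous d0 cv.
pose gP (z : R * 'rV[R]_N) := trunc d u z * p z.2 - trunc d v z * q z.2.
pose gQ (z : R * 'rV[R]_N) := trunc d u z * q z.2 + trunc d v z * p z.2.
(* With c = [C0] this dominates [gP] and [gQ]; with c = [C1] it dominates the divergence. *)
pose gW c (z : R * 'rV[R]_N) := c * (`|trunc d u z| + `|trunc d v z|).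
have cgP : continuous gP by move=> z; apply: cvgB; exact: continuous_weight.
have cgQ : continuous gQ by move=> z; apply: cvgD; exact: continuous_weight.
have cgW c : continuous (gW c).
  by move=> z; apply: cvgM; [exact: cvg_cst|apply: cvgD; apply: cvg_norm; [exact: cu'|exact: cv']].
have truncE (f : R * 'rV[R]_N -> R) (t : R) x : a <= t -> trunc d f (t, x) = f (t, x).
  move=> at_; rewrite /trunc/=; congr (f (_, _)).
  by apply/max_idPl; rewrite /d; lra.
pose lift (g : R * 'rV[R]_N -> R) (z : R * N.-tuple mR) := g (z.1, row_of_tuple z.2).
have lift_along (g : R * 'rV[R]_N -> R) x : (fun z : R * R => lift g (z.2, coord_shift z.1 x)) =
    (fun z => g (z.2, row_of_tuple x + z.1 *: e)).
  by apply/funext => z; rewrite /lift /= row_coord_shift.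
have mlift (g : R * 'rV[R]_N -> R) : continuous g -> measurable_fun setT (lift g : mR * N.-tuple mR -> R).
  exact: continuous_prod_row_measurable.
have msec (g : R * 'rV[R]_N -> R) (t : R) : continuous g -> measurable_fun setT (fun x : N.-tuple mR => lift g (t, x)).
  by move=> cg; exact: (measurableT_comp (mlift g cg) (pair1_measurable (t : mR))).
have W_le (c t : R) : 0 <= c -> a <= t <= b ->
    (\int[mu]_x (lift (gW c) (t, x))%:E <= (c * (M + M))%:E)%E.
  move=> c0 /andP[at_ tb].
  have t0 : 0 < t by exact: lt_le_trans at_.
  under eq_integral do rewrite /lift /gW/= !truncE// EFinM EFinD.
  have mabs (f : R * 'rV[R]_N -> R) : (forall z : R * 'rV[R]_N, 0 < z.1 -> {for z, continuous f}) ->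
      measurable_fun setT (fun x : N.-tuple mR => `|f (t, row_of_tuple x)|%:E).
    move=> cf; have := msec (trunc d f) t (trunc_continuous d0 cf).
    rewrite /lift /= => mf; apply/measurable_EFinP; apply: measurableT_comp => //.
    by apply: eq_measurable_fun mf => x _; rewrite /= truncE.
  rewrite ge0_integralZl//; last 2 first.
  - by apply: emeasurable_funD; exact: mabs.
  - by move=> x _; rewrite adde_ge0.
  rewrite ge0_integralD//; [|exact: mabs|exact: mabs].
  rewrite EFinM EFinD lee_wpmul2l ?lee_fin// leeD//; [exact: uM|exact: vM].
have lift_le (g : R * 'rV[R]_N -> R) (c t : R) : 0 <= c -> continuous g -> (forall z, `|g z| <= gW c z) -> a <= t <= b ->
    (\int[mu]_x `|lift g (t, x)|%:E <= (c * (M + M))%:E)%E.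
  move=> c0 cg gc tab; apply: le_trans (W_le c t c0 tab).
  apply: ge0_le_integral => //.
  - by apply/measurable_EFinP; apply: measurableT_comp => //; exact: msec.
  - by apply/measurable_EFinP; exact: msec.
  - by move=> x _; rewrite lee_fin; exact: gc.
have tri (x y x' y' : R) : `|x' | <= C0 -> `|y'| <= C0 ->
    `|x * x'| + `|y * y'| <= C0 * (`|x| + `|y|).
  move=> hx hy; rewrite !normrM mulrDr lerD//.
    by rewrite mulrC ler_wpM2r.
  by rewrite mulrC ler_wpM2r.
have gPW z : `|gP z| <= gW C0 z.
  by apply: le_trans (ler_normB _ _) _; apply: tri.
have gQW z : `|gQ z| <= gW C0 z.
  by apply: le_trans (ler_normD _ _) _; apply: tri.
have gW0 z : 0 <= gW C1 z by rewrite mulr_ge0// addr_ge0.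
have ae : a <= a <= b by rewrite lexx ltW.
have be : a <= b <= b by rewrite lexx ltW.
have PE t : a <= t -> \int[mu]_x (lift gP (t, x)) =
   \int[mu]_x (u (t, row_of_tuple x) * p (row_of_tuple x) -
               v (t, row_of_tuple x) * q (row_of_tuple x)).
  by move=> at_; apply: eq_Rintegral => x _; rewrite /lift /gP /= !truncE.
rewrite -!PE ?(ltW ab)//.
apply: (@flow_lipschitz _ _ R (@lebesgue_tuple_measure R N) coord_shift
  measurable_coord_shift (fun s => @lebesgue_tuple_shift R N _)
  (lift gP) (lift gQ) (lift (gW C1)) a b (C0 * (M + M)) (C1 * (M + M)) ab).
- exact: mlift.
- exact: mlift.
- exact: mlift.
- by move=> z; exact: gW0.
- by move=> t; exact: lift_le.
- by move=> t; exact: lift_le.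
- by move=> t; exact: W_le.
- by move=> x; rewrite lift_along; exact: along_continuous.
- by move=> x; rewrite lift_along; exact: along_continuous.
move=> x; rewrite !lift_along.
apply: (circulation_le (W := fun z => lift (gW C1) (z.2, coord_shift z.1 x))).
- exact: along_continuous.
- exact: along_continuous.
- by rewrite lift_along; exact: along_continuous.
- exact: (measurableT_comp (mlift _ (cgW C1)) (measurable_fun_pair measurable_snd
    (measurableT_comp measurable_coord_shift (measurable_fun_pair measurable_fst (measurable_cst x))))).
- by move=> z; exact: gW0.
- by rewrite subr_gt0.
move=> [s t] /= _ /andP[at_ _].
have [a1 [b1 [du dv]]] := CR (row_of_tuple x) s (lt_le_trans a0 at_).
have near_trunc (f : R * 'rV[R]_N -> R) : \forall w \near ((s, t) : R * R),
    f (w.2, row_of_tuple x + w.1 *: e) = trunc d f (w.2, row_of_tuple x + w.1 *: e).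
  have : \forall w \near ((s, t) : R * R), d < w.2.
    have : (snd : R * R -> R) w @[w --> ((s, t) : R * R)] --> t by exact: cvg_snd.
    by move=> /cvgr_gt; apply; rewrite /d; lra.
  by apply: filterS => w dw; rewrite /trunc/= (max_idPl (ltW dw)).
have := divergence_complex_product (is_diff_lin2_near du (near_trunc u))
  (is_diff_lin2_near dv (near_trunc v))
  (is_diff_lin2_shift (s := s) t (@dp (row_of_tuple x + s *: e)))
  (is_diff_lin2_shift (s := s) t (@dq (row_of_tuple x + s *: e))).
move=> [dP dQ E]; split; [exact: dP|exact: dQ|].
have -> : lift (gW C1) (t, coord_shift s x) =
    gW C1 (t, row_of_tuple x + s *: e) by rewrite /lift row_coord_shift.
have := congr1 Num.norm E => /= {}E; apply: le_trans (_ : `|_ + _| <= _).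
  by rewrite le_eqVlt; apply/orP; left; apply/eqP; exact: E.
rewrite /gW /= mulrDr; apply: le_trans (ler_normD _ _) _.
by rewrite !normrM lerD// mulrC ler_wpM2r.
Qed.

End lipschitz.

(** * Schwartz functions and tempered functionals *)

Section schwartz_theory.
Context {R : realType} {N : nat}.
Implicit Types (psi phi : 'rV[R]_N -> R[i]^o).

Let zero : {ffun 'I_N -> nat} := [ffun=> 0%N].

Lemma mpartial0 (g : 'rV[R]_N -> R) : mpartial zero g = g.
Proof.
rewrite /mpartial (_ : flatten _ = [::])//.
by elim: (enum 'I_N) => //= j s ->; rewrite ffunE.
Qed.

Lemma mpartial1 (i : 'I_N) (g : 'rV[R]_N -> R) :
  mpartial [ffun j => (j == i) : nat] g = 'D_(delta_mx 0 i) g.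
Proof.
rewrite /mpartial (_ : flatten _ = [:: i])//.
have : uniq (enum 'I_N) := enum_uniq _; have : i \in enum 'I_N by rewrite mem_enum.
have nil s : i \notin s -> flatten [seq nseq ([ffun j => (j == i) : nat] j) j | j <- s] = [::].
  elim: s => //= j s IH; rewrite inE negb_or => /andP[ij /IH ->].
  by rewrite ffunE eq_sym (negbTE ij).
elim: (enum 'I_N) => //= j s IH; rewrite inE ffunE.
have [<- _ /andP[/nil -> _]|ji /= is_ /andP[_ us]] := eqVneq i j.
  by [].
exact: IH.
Qed.

Lemma monomial0 (x : 'rV[R]_N) : monomial zero x = 1.
Proof. by rewrite /monomial big1// => i _; rewrite ffunE expr0. Qed.

Lemma seminorm_ge b psi x :
  ((normc (mpartialC b psi x))%:E <= seminorm (zero, b) psi)%E.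
Proof. by apply: ereal_sup_ubound; exists x => //=; rewrite monomial0 normr1 mulr1. Qed.

Lemma seminorm0_ge psi x : ((normc (psi x))%:E <= seminorm (zero, zero) psi)%E.
Proof.
have := seminorm_ge zero psi x; rewrite /mpartialC !mpartial0 /=.
by case: (psi x).
Qed.

Lemma schwartz_bounded b psi : schwartz psi ->
  exists C : R, forall x, normc (mpartialC b psi x) <= C.
Proof.
move=> [_ _ /(_ (zero, b)) sb]; exists (fine (seminorm (zero, b) psi)) => x.
have h := seminorm_ge b psi x; rewrite -lee_fin fineK// fin_numE (lt_eqF sb) andbT.
by rewrite gt_eqF// (lt_le_trans _ h)// ltNyr.
Qed.

Lemma schwartz_continuous psi : schwartz psi ->
  continuous (@complex.Re R \o psi) /\ continuous (@complex.Im R \o psi).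
Proof. by move=> [/(_ [::])[? _] /(_ [::])[? _] _]. Qed.

(** The supremum norm is the seminorm with both multi-indices zero, so a Lipschitz bound in it gives
    continuity on the Schwartz space. *)
Lemma lipschitz_tempered (u : ('rV[R]_N -> R[i]^o) -> R[i]^o) (K : R) :
  (forall (c : R[i]) phi psi, schwartz phi -> schwartz psi ->
     u (fun x => c * phi x + psi x) = c * u phi + u psi) ->
  (forall phi psi c, schwartz phi -> schwartz psi ->
     (forall x, normc (phi x - psi x) <= c) -> normc (u phi - u psi) <= K * c) ->
  tempered u.
Proof.
move=> ulin uK; split => // psi spsi A /nbhs_ballP[[e e'] /=].
rewrite ltcE/= => /andP[/eqP -> e0] eA.
have K0 : 0 < `|K| + 1 by rewrite ltr_wpDl.
(* The denominator is positive whatever the sign of [K], and at least [K]. *)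
exists ([:: (zero, zero)], e / (`|K| + 1)) => /=; first exact: divr_gt0.
move=> phi [sphi /(_ _ (mem_head _ _)) near_phi]; apply: eA.
rewrite /ball/= -[_ +i* 0]/(e%:C) distrC normc_norm ltcR.
have h x : normc (phi x - psi x) <= e / (`|K| + 1).
  rewrite -lee_fin; apply: ltW; apply: le_lt_trans near_phi.
  exact: (seminorm0_ge (fun x => phi x - psi x)).
apply: le_lt_trans (uK _ _ _ sphi spsi h) _.
rewrite mulrCA -[ltRHS]mulr1 ltr_pM2l// ltr_pdivrMr// mul1r.
by rewrite (le_lt_trans (ler_norm K))// ltrDl.
Qed.

End schwartz_theory.

(** * Complex integrals, and integrable functions as tempered distributions *)

Section complex_integral.
Context {R : realType} {N : nat}.
Implicit Types (F g h phi psi : 'rV[R]_N -> R[i]^o).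
Local Notation mu := (@lebesgue_tuple R N).

Definition integrableC g :=
  mu.-integrable setT (fun x => (complex.Re (g (row_of_tuple x)))%:E) /\
  mu.-integrable setT (fun x => (complex.Im (g (row_of_tuple x)))%:E).

Definition continuousC g :=
  continuous (@complex.Re R \o g) /\ continuous (@complex.Im R \o g).

Lemma ReMc (z w : R[i]) : complex.Re (z * w) =
  complex.Re z * complex.Re w - complex.Im z * complex.Im w.
Proof. by case: z w => ? ? [? ?]. Qed.

Lemma ImMc (z w : R[i]) : complex.Im (z * w) =
  complex.Re z * complex.Im w + complex.Im z * complex.Re w.
Proof. by case: z w => ? ? [? ?]. Qed.

Lemma ReDc (z w : R[i]) : complex.Re (z + w) = complex.Re z + complex.Re w.
Proof. by case: z w => ? ? [? ?]. Qed.

Lemma ImDc (z w : R[i]) : complex.Im (z + w) = complex.Im z + complex.Im w.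
Proof. by case: z w => ? ? [? ?]. Qed.

Lemma continuousCM g h : continuousC g -> continuousC h ->
  continuousC (fun x => g x * h x).
Proof.
move=> [gR gI] [hR hI]; split.
  rewrite (_ : _ \o _ = (fun x => complex.Re (g x) * complex.Re (h x) -
     complex.Im (g x) * complex.Im (h x))); last by apply/funext => x; rewrite -ReMc.
  by move=> x; exact: (cvgB (cvgM (gR x) (hR x)) (cvgM (gI x) (hI x))).
rewrite (_ : _ \o _ = (fun x => complex.Re (g x) * complex.Im (h x) +
   complex.Im (g x) * complex.Re (h x))); last by apply/funext => x; rewrite -ImMc.
by move=> x; exact: (cvgD (cvgM (gR x) (hI x)) (cvgM (gI x) (hR x))).
Qed.

Lemma measurable_normc g : continuousC g ->
  measurable_fun setT (fun x : N.-tuple (measurableTypeR R) =>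
    (normc (g (row_of_tuple x)))%:E).
Proof.
move=> [gR gI]; apply/measurable_EFinP.
apply: (continuous_row_measurable (g := fun x => normc (g x))) => x.
rewrite (_ : (fun x => _) = (fun x => Num.sqrt (complex.Re (g x) ^+ 2 + complex.Im (g x) ^+ 2))).
  apply: (@continuous_comp _ _ _ (fun x => complex.Re (g x) ^+ 2 + complex.Im (g x) ^+ 2)
    (@Num.sqrt R)); last exact: sqrt_continuous.
  by exact: (cvgD (cvgM (gR x) (gR x)) (cvgM (gI x) (gI x))).
by apply/funext => y; case: (g y).
Qed.

Lemma integrableC_continuous g (B : R) : continuousC g ->
  (\int[mu]_x (normc (g (row_of_tuple x)))%:E <= B%:E)%E -> integrableC g.
Proof.
move=> cg gB; have [gR gI] := cg.
have dom (f : 'rV[R]_N -> R) : continuous f -> (forall x, `|f x| <= normc (g x)) ->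
    mu.-integrable setT (fun x => (f (row_of_tuple x))%:E).
  move=> cf fg; apply/integrableP; split.
    by apply/measurable_EFinP; exact: continuous_row_measurable.
  apply: le_lt_trans (ltry B); apply: le_trans gB; apply: ge0_le_integral => //.
  - by apply/measurable_EFinP/measurableT_comp => //; exact: continuous_row_measurable.
  - exact: measurable_normc.
  - by move=> x _; rewrite lee_fin.
by split; [apply: (dom _ gR) => x; exact: normRe_le|apply: (dom _ gI) => x; exact: normIm_le].
Qed.

Lemma integralC_linear (c : R[i]) g h : integrableC g -> integrableC h ->
  integralC (fun x => c * g x + h x) = c * integralC g + integralC h.
Proof.
move=> [gR gI] [hR hI].
apply/eqP; rewrite eq_complex ReDc ImDc ReMc ImMc /integralC /=.
have iZ (k : R) (f : N.-tuple (measurableTypeR R) -> R) :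
    mu.-integrable setT (fun x => (f x)%:E) -> mu.-integrable setT (fun x => (k * f x)%:E).
  move=> fi; have := integrableZl measurableT k fi.
  by apply: eq_integrable => // x _; rewrite EFinM.
apply/andP; split; apply/eqP.
  under eq_Rintegral do rewrite ReDc ReMc.
  rewrite RintegralD// ?RintegralB// ?RintegralZl//; try exact: iZ.
  have := integrableB measurableT (iZ (complex.Re c) _ gR) (iZ (complex.Im c) _ gI).
  by apply: eq_integrable => // x _; rewrite EFinB.
under eq_Rintegral do rewrite ImDc ImMc.
rewrite RintegralD// ?RintegralD// ?RintegralZl//; try exact: iZ.
have := integrableD measurableT (iZ (complex.Re c) _ gI) (iZ (complex.Im c) _ gR).
by apply: eq_integrable => // x _; rewrite EFinD.
Qed.

(** Real and imaginary parts are estimated separately, which costs a factor 2. *)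
Lemma normc_integralC_le g (B : R) : continuousC g ->
  (\int[mu]_x (normc (g (row_of_tuple x)))%:E <= B%:E)%E ->
  normc (integralC g) <= B + B.
Proof.
move=> cg gB; have [iR iI] := integrableC_continuous cg gB.
have bound (f : 'rV[R]_N -> R) : mu.-integrable setT (fun x => (f (row_of_tuple x))%:E) ->
    (forall x, `|f x| <= normc (g x)) -> `|\int[mu]_x f (row_of_tuple x)| <= B.
  move=> fi fg; rewrite -lee_fin; apply: le_trans gB.
  rewrite EFin_normr_Rintegral//.
  apply: le_trans (le_abse_integral _ _ _) _ => //; first exact: measurable_int fi.
  apply: ge0_le_integral => //.
  - by apply: measurableT_comp => //; exact: measurable_int fi.
  - exact: measurable_normc.
  - by move=> x _; rewrite lee_fin.
apply: le_trans (normc_le_ReIm _) _; rewrite lerD//=.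
  by apply: (bound (fun y => complex.Re (g y)) iR) => x; exact: normRe_le.
by apply: (bound (fun y => complex.Im (g y)) iI) => x; exact: normIm_le.
Qed.

Variables (F : 'rV[R]_N -> R[i]^o) (M : R).
Hypothesis cF : continuousC F.
Hypothesis FM : (\int[mu]_x (normc (F (row_of_tuple x)))%:E <= M%:E)%E.

Lemma integral_normcM_le phi (C : R) : continuousC phi ->
  (forall x, normc (phi x) <= C) ->
  (\int[mu]_x (normc (F (row_of_tuple x) * phi (row_of_tuple x)))%:E <= (M * C)%:E)%E.
Proof.
move=> cphi phiC.
have nz (z : R[i]) : 0 <= normc z by exact: le_trans (normr_ge0 _) (normRe_le _).
have C0 : 0 <= C by exact: le_trans (nz _) (phiC 0).
apply: (@le_trans _ _ (\int[mu]_x (C%:E * (normc (F (row_of_tuple x)))%:E))%E).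
  apply: ge0_le_integral => //.
  - by move=> x _; rewrite lee_fin.
  - exact: (measurable_normc (continuousCM cF cphi)).
  - by apply: measurable_funeM; exact: measurable_normc.
  - by move=> x _; rewrite normcM -EFinM lee_fin mulrC ler_wpM2r.
rewrite ge0_integralZl//; last 2 first.
- exact: measurable_normc.
- by move=> x _; rewrite lee_fin.
by rewrite mulrC EFinM lee_wpmul2l.
Qed.

Lemma distribution_of_linear (c : R[i]) phi psi : schwartz phi -> schwartz psi ->
  distribution_of F (fun x => c * phi x + psi x) =
  c * distribution_of F phi + distribution_of F psi.
Proof.
move=> sphi spsi; rewrite /distribution_of.
have iF eta : schwartz eta -> integrableC (fun x => F x * eta x).
  move=> seta; have ceta := schwartz_continuous seta.
  have [C etaC] := schwartz_bounded [ffun=> 0%N] seta.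
  apply: integrableC_continuous (integral_normcM_le (C := C) _ _) => //.
    exact: continuousCM.
  by move=> x; have := etaC x; rewrite /mpartialC !mpartial0 /=; case: (eta x).
rewrite -integralC_linear; [|exact: iF|exact: iF].
by congr integralC; apply/funext => x; ring.
Qed.

(** The difference is the pairing of [F] with a bounded continuous function. The constant depends on
    [F] only through its L^1 bound, hence is uniform over the slices of a Hardy function. *)
Lemma distribution_of_lipschitz phi psi (C : R) : schwartz phi -> schwartz psi ->
  (forall x, normc (phi x - psi x) <= C) ->
  normc (distribution_of F phi - distribution_of F psi) <= (M + M) * C.
Proof.
move=> sphi spsi phipsi.
have [pR pI] := schwartz_continuous sphi; have [sR sI] := schwartz_continuous spsi.
have cB : continuousC (fun x => phi x - psi x).
  split.
    rewrite (_ : _ \o _ = (fun x => complex.Re (phi x) - complex.Re (psi x))).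
      by move=> x; exact: (cvgB (pR x) (sR x)).
    by apply/funext => x /=; case: (phi x) (psi x) => ? ? [].
  rewrite (_ : _ \o _ = (fun x => complex.Im (phi x) - complex.Im (psi x))).
    by move=> x; exact: (cvgB (pI x) (sI x)).
  by apply/funext => x /=; case: (phi x) (psi x) => ? ? [].
have iF eta (D : R) : continuousC eta -> (forall x, normc (eta x) <= D) ->
    integrableC (fun x => F x * eta x).
  move=> ceta etaD.
  by apply: integrableC_continuous (continuousCM cF ceta) (integral_normcM_le ceta etaD).
have [D psiD] := schwartz_bounded [ffun=> 0%N] spsi.
have -> : distribution_of F phi - distribution_of F psi =
    integralC (fun x => F x * (phi x - psi x)).
  apply/(canLR (addrK _)); rewrite -[X in _ = X + _]mul1r /distribution_of -integralC_linear.
  - by congr integralC; apply/funext => x; ring.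
  - exact: iF cB phipsi.
  - apply: (iF psi D) => // x.
    by have := psiD x; rewrite /mpartialC !mpartial0 /=; case: (psi x).
have := normc_integralC_le (continuousCM cF cB) (integral_normcM_le cB phipsi).
by rewrite mulrDl.
Qed.

Lemma tempered_distribution_of : tempered (distribution_of F).
Proof.
exact: lipschitz_tempered distribution_of_linear distribution_of_lipschitz.
Qed.

End complex_integral.

(** * Coordinates on the Siegel domain *)

Section siegel_coordinates.
Context {R : realType}.

(** One factor of [pi_map], in the real coordinates of the group. *)
Definition siegel_point (n : nat) (t : R) (y : 'rV[R]_(heis_dim n)) :
    R[i]^o * 'rV[R[i]^o]_n :=
  let g := heis_of_row y in (g.1 +i* (t + normsq g.2), g.2).

(** Index of the coordinate s, which parametrizes the centre of the group. *)
Definition heis_center (n : nat) : 'I_(heis_dim n) := lshift (n + n) ord0.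

(** A central translation fixes z and hence |z|^2, so moving s and t together is a complex
    translation of w alone. *)
Lemma siegel_point_shift (n : nat) (t s dt : R) (y : 'rV[R]_(heis_dim n)) :
  siegel_point (t + dt) (y + s *: delta_mx 0 (heis_center n)) =
  siegel_point t y + (s +i* dt) *: ((1, 0) : R[i]^o * 'rV[R[i]^o]_n).
Proof.
have zE : (heis_of_row (y + s *: delta_mx 0 (heis_center n))).2 = (heis_of_row y).2.
  by apply/rowP => j; rewrite !mxE !eq_rlshift !andbF !mulr0 !addr0.
rewrite /siegel_point zE; congr (_, _); last by rewrite /= scaler0 addr0.
rewrite /= !mxE eqxx lshift0 /=.
by rewrite /GRing.scale /= !mulr1; apply/eqP; rewrite eq_complex /= eqxx addrAC eqxx.
Qed.

Lemma normsqE (n : nat) (z : 'rV[R[i]]_n) :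
  normsq z = \sum_j (complex.Re (z 0 j) ^+ 2 + complex.Im (z 0 j) ^+ 2).
Proof.
apply: eq_bigr => j _; case: (z 0 j) => a b /=.
by rewrite sqr_sqrtr// addr_ge0 ?sqr_ge0.
Qed.

Lemma continuous_siegel_point (n : nat) :
  continuous (fun p : R * 'rV[R]_(heis_dim n) => siegel_point p.1 p.2).
Proof.
have coord k : continuous (fun p : R * 'rV[R]_(heis_dim n) => p.2 0 k).
  move=> p; apply: (@continuous_comp _ _ _ snd (fun y : 'rV[R]_(heis_dim n) => y 0 k)).
    exact: cvg_snd.
  exact: coord_continuous.
pose re j : 'I_(heis_dim n) := rshift 1 (lshift n j).
pose im j : 'I_(heis_dim n) := rshift 1 (rshift n j).
have zE (p : R * 'rV[R]_(heis_dim n)) j :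
    (heis_of_row p.2).2 0 j = p.2 0 (re j) +i* p.2 0 (im j) by rewrite !mxE.
have c1 : continuous (fun q : R * 'rV[R]_(heis_dim n) => (siegel_point q.1 q.2).1).
  apply: (continuous_complex (f := fun q => (heis_of_row q.2).1)
    (g := fun q => q.1 + normsq (heis_of_row q.2).2)) => q.
    suff -> : (fun q : R * 'rV[R]_(heis_dim n) => (heis_of_row q.2).1) =
      (fun q => q.2 0 (heis_center n)) by exact: coord.
    by apply/funext => r; rewrite /= !mxE.
  suff cn : continuous (fun q : R * 'rV[R]_(heis_dim n) => normsq (heis_of_row q.2).2).
    by apply: cvgD; [exact: cvg_fst|exact: cn].
  rewrite (_ : (fun q => _) = (fun q : R * 'rV[R]_(heis_dim n) =>
    \sum_j (q.2 0 (re j) * q.2 0 (re j) + q.2 0 (im j) * q.2 0 (im j)))).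
    apply: (continuous_big (op := +%R)) => [|j _ r]; first exact: add_continuous.
    exact: (cvgD (cvgM (coord _ _) (coord _ _)) (cvgM (coord _ _) (coord _ _))).
  by apply/funext => r; rewrite normsqE; apply: eq_bigr => j _; rewrite zE.
move=> p.
apply: (@cvg_pair _ _ _ (nbhs p) (nbhs (siegel_point p.1 p.2).1)
  (nbhs (siegel_point p.1 p.2).2) _ _ _); first exact: c1.
apply: cvg_row => j.
suff -> : (fun q : R * 'rV[R]_(heis_dim n) => (siegel_point q.1 q.2).2 ord0 j) =
    (fun q => q.2 0 (re j) +i* q.2 0 (im j)).
  by rewrite zE; exact: (continuous_complex (coord (re j)) (coord (im j))).
by apply/funext => q; rewrite zE.
Qed.

End siegel_coordinates.

(** * The product domain and the slices of a holomorphic function *)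

Section hardy.
Context {R : realType} {n1 n2 : nat}.
Local Notation N := (heis_dim n1 + heis_dim n2)%N.
Local Notation V := ((R[i]^o * 'rV[R[i]^o]_n1) * (R[i]^o * 'rV[R[i]^o]_n2))%type.
Implicit Types (t : R * R) (x : 'rV[R]_N).

Definition siegel2_point t x : V :=
  (siegel_point t.1 (lsubmx x), siegel_point t.2 (rsubmx x)).

Lemma siegel2_pointE t x : siegel2_point t x = pi_map (t, heis2_of_row x).
Proof.
case: t => t1 t2; rewrite /siegel2_point /siegel_point /=.
by congr ((_, _), (_, _)); apply/eqP; rewrite eq_complex /= addr0 !eqxx.
Qed.

Lemma calU_siegel2_point t x : pos2 t -> calU (siegel2_point t x).
Proof. by move=> t0; rewrite siegel2_pointE; apply/pi_map_calU. Qed.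

Lemma continuous_siegel2_point :
  continuous (fun p : (R * R) * 'rV[R]_N => siegel2_point p.1 p.2).
Proof.
have cl : continuous (fun x => lsubmx x : 'rV[R]_(heis_dim n1)).
  move=> x; apply: (@cvg_row _ _ _ (nbhs x) _ _ _) => j.
  suff -> : (fun x => lsubmx x ord0 j) = (fun x : 'rV[R]_N => x ord0 (lshift _ j)).
    by rewrite mxE; exact: coord_continuous.
  by apply/funext => y; rewrite mxE.
have cr : continuous (fun x => rsubmx x : 'rV[R]_(heis_dim n2)).
  move=> x; apply: (@cvg_row _ _ _ (nbhs x) _ _ _) => j.
  suff -> : (fun x => rsubmx x ord0 j) = (fun x : 'rV[R]_N => x ord0 (rshift _ j)).
    by rewrite mxE; exact: coord_continuous.
  by apply/funext => y; rewrite mxE.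
move=> p.
have part n (g : R * R -> R) (h : 'rV[R]_N -> 'rV[R]_(heis_dim n)) :
    continuous g -> continuous h ->
    {for p, continuous (fun p : (R * R) * 'rV[R]_N => siegel_point (g p.1) (h p.2))}.
  move=> cg ch.
  apply: (@continuous_comp _ _ _ (fun p : (R * R) * 'rV[R]_N => (g p.1, h p.2))
    (fun q => siegel_point q.1 q.2)); last exact: continuous_siegel_point.
  apply: (@cvg_pair _ _ _ (nbhs p) (nbhs (g p.1)) (nbhs (h p.2)) _ _ _).
    by apply: (@continuous_comp _ _ _ fst g); [exact: cvg_fst|exact: cg].
  by apply: (@continuous_comp _ _ _ snd h); [exact: cvg_snd|exact: ch].
apply: (@cvg_pair _ _ _ (nbhs p) (nbhs (siegel2_point p.1 p.2).1)
  (nbhs (siegel2_point p.1 p.2).2) _ _ _).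
  by apply: part => // t; exact: cvg_fst.
by apply: part => // t; exact: cvg_snd.
Qed.

Variable f : (R * R) * (heis R n1 * heis R n2) -> R[i]^o.
Hypothesis holf : holomorphic_scrU f.

Lemma sliceE t x : slice f t x = (f \o @Defs.pi_inv R n1 n2) (siegel2_point t x).
Proof. by rewrite siegel2_pointE -[RHS]/(f (Defs.pi_inv (pi_map _))) pi_mapK. Qed.

(** Complex differentiability gives continuity on [calU], and [siegel2_point] maps continuously into
    [calU] at positive times. *)
Lemma slice_continuous (p : (R * R) * 'rV[R]_N) : pos2 p.1 ->
  {for p, continuous (fun p : (R * R) * 'rV[R]_N => slice f p.1 p.2)}.
Proof.
move=> t0; rewrite (_ : (fun p => _) = (f \o @Defs.pi_inv R n1 n2) \o
    (fun p : (R * R) * 'rV[R]_N => siegel2_point p.1 p.2)); last first.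
  by apply/funext => q; rewrite sliceE.
apply: (@continuous_comp _ _ _ (fun p : (R * R) * 'rV[R]_N => siegel2_point p.1 p.2)
  (f \o @Defs.pi_inv R n1 n2)); first exact: continuous_siegel2_point.
by apply: differentiable_continuous; apply: holf; exact: calU_siegel2_point.
Qed.

Lemma continuousC_slice t : pos2 t -> continuousC (slice f t).
Proof.
move=> t0; have c x : slice f t y @[y --> x] --> slice f t x.
  apply: (@continuous_comp _ _ _ (fun x => (t, x)) (fun p => slice f p.1 p.2)).
    by apply: (@cvg_pair _ _ _ (nbhs x) (nbhs t) (nbhs x) _ _ _); [exact: cvg_cst|exact: cvg_id].
  exact: slice_continuous.
by split=> x; have [] := (cvg_complexP _ _ _).1 (c x).
Qed.

Definition center1 : 'I_N := lshift _ (heis_center n1).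
Definition center2 : 'I_N := rshift _ (heis_center n2).

Lemma siegel2_point_shift1 (t1 t2 s dt : R) x :
  siegel2_point (t1 + dt, t2) (x + s *: delta_mx 0 center1) =
  siegel2_point (t1, t2) x + (s +i* dt) *: (((1, 0), 0) : V).
Proof.
rewrite /siegel2_point /=.
have -> : lsubmx (x + s *: delta_mx 0 center1) = lsubmx x + s *: delta_mx 0 (heis_center n1).
  by apply/rowP => j; rewrite !mxE eq_lshift.
have -> : rsubmx (x + s *: delta_mx 0 center1) = rsubmx x.
  by apply/rowP => j; rewrite !mxE eq_rlshift andbF mulr0 addr0.
by rewrite siegel_point_shift; congr (_, _); rewrite /= scaler0 addr0.
Qed.

Lemma siegel2_point_shift2 (t1 t2 s dt : R) x :
  siegel2_point (t1, t2 + dt) (x + s *: delta_mx 0 center2) =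
  siegel2_point (t1, t2) x + (s +i* dt) *: ((0, (1, 0)) : V).
Proof.
rewrite /siegel2_point /=.
have -> : rsubmx (x + s *: delta_mx 0 center2) = rsubmx x + s *: delta_mx 0 (heis_center n2).
  by apply/rowP => j; rewrite !mxE eq_rshift.
have -> : lsubmx (x + s *: delta_mx 0 center2) = lsubmx x.
  by apply/rowP => j; rewrite !mxE eq_lrshift andbF mulr0 addr0.
by rewrite siegel_point_shift; congr (_, _); rewrite /= scaler0 addr0.
Qed.

End hardy.

(** * Boundary values *)

Section hardy_pairing.
Context {R : realType} {n1 n2 : nat}.
Local Notation N := (heis_dim n1 + heis_dim n2)%N.
Local Notation V := ((R[i]^o * 'rV[R[i]^o]_n1) * (R[i]^o * 'rV[R[i]^o]_n2))%type.
Variable f : (R * R) * (heis R n1 * heis R n2) -> R[i]^o.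
Variable M : R.
Hypothesis holf : holomorphic_scrU f.
Hypothesis fM : forall t, pos2 t ->
  (\int[lebesgue_tuple N]_x (normc (slice f t (row_of_tuple x)))%:E <= M%:E)%E.

(** The path [gam] varies one of the two times and [v] is the matching complex direction, so one
    statement serves both factors. [K] is chosen before [gam], hence is uniform in the time that
    stays fixed. *)
Lemma distribution_of_slice_lipschitz (i : 'I_N) (psi : 'rV[R]_N -> R[i]^o) :
  schwartz psi -> exists2 K, 0 <= K & forall (gam : R -> R * R) (v : V),
  (forall t, 0 < t -> pos2 (gam t)) -> continuous gam ->
  (forall t dt s (x : 'rV[R]_N),
    siegel2_point (gam (t + dt)) (x + s *: delta_mx 0 i) =
    siegel2_point (gam t) x + (s +i* dt) *: v) ->
  forall a b, 0 < a -> 0 < b ->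
  normc (distribution_of (slice f (gam a)) psi -
         distribution_of (slice f (gam b)) psi) <= K * `|a - b|.
Proof.
move=> spsi.
have [C0 psiC0] := schwartz_bounded [ffun=> 0%N] spsi.
have [C1 psiC1] := schwartz_bounded [ffun j => (j == i) : nat] spsi.
have {}psiC0 x : normc (psi x) <= C0.
  by have := psiC0 x; rewrite /mpartialC !mpartial0 /=; case: (psi x).
have [cp cq] := schwartz_continuous spsi.
have [smp smq _] := spsi.
set p := @complex.Re R \o psi in cp smp; set q := @complex.Im R \o psi in cq smq.
have dp x : derivable p x (delta_mx 0 i) := (smp [::]).2 x i.
have dq x : derivable q x (delta_mx 0 i) := (smq [::]).2 x i.
have pC0 x : `|p x| <= C0 := le_trans (normRe_le _) (psiC0 x).
have qC0 x : `|q x| <= C0 := le_trans (normIm_le _) (psiC0 x).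
have pC1 x : `|'D_(delta_mx 0 i) p x| <= C1.
  by apply: le_trans (psiC1 x); rewrite /mpartialC !mpartial1; exact: (normRe_le (_ +i* _)).
have qC1 x : `|'D_(delta_mx 0 i) q x| <= C1.
  by apply: le_trans (psiC1 x); rewrite /mpartialC !mpartial1; exact: (normIm_le (_ +i* _)).
(* One summand for the real part and one for the imaginary part. *)
exists (`|C1 * (M + M)| + `|C1 * (M + M)|) => [|gam v gpos cgam gshift a b a0 b0].
  by rewrite addr_ge0.
wlog ab : a b a0 b0 / a < b.
  move=> H; have [ab|ba|->] := ltgtP a b; first exact: H.
    by rewrite -normcN opprB distrC; exact: H.
  by rewrite !subrr normr0 mulr0 normc0.
pose u (z : R * 'rV[R]_N) := complex.Re (slice f (gam z.1) z.2).
pose w (z : R * 'rV[R]_N) := complex.Im (slice f (gam z.1) z.2).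
have cuw (z : R * 'rV[R]_N) : 0 < z.1 ->
    slice f (gam z'.1) z'.2 @[z' --> z] --> slice f (gam z.1) z.2.
  move=> z0.
  apply: (@continuous_comp _ _ _ (fun z : R * 'rV[R]_N => (gam z.1, z.2))
    (fun p => slice f p.1 p.2)).
    apply: (@cvg_pair _ _ _ (nbhs z) (nbhs (gam z.1)) (nbhs z.2) _ _ _).
      by apply: (@continuous_comp _ _ _ fst gam); [exact: cvg_fst|exact: cgam].
    exact: cvg_snd.
  by apply: slice_continuous => //; exact: gpos.
have cu (z : R * 'rV[R]_N) : 0 < z.1 -> {for z, continuous u}.
  by move=> /cuw/cvg_complexP[].
have cw (z : R * 'rV[R]_N) : 0 < z.1 -> {for z, continuous w}.
  by move=> /cuw/cvg_complexP[].
have CR (x : 'rV[R]_N) (s t : R) : 0 < t -> exists a b : R,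
    is_diff (s, t) (fun p : R * R => u (p.2, x + p.1 *: delta_mx 0 i)) (lin2 a (- b)) /\
    is_diff (s, t) (fun p : R * R => w (p.2, x + p.1 *: delta_mx 0 i)) (lin2 b a).
  move=> t0; pose z := siegel2_point (gam t) (x + s *: delta_mx 0 i).
  have /(complex_direction_diff v s t)[a1 [b1 [dRe dRe' dIm dIm']]] :
      differentiable (f \o @Defs.pi_inv R n1 n2) z.
    by apply: holf; apply: calU_siegel2_point; exact: gpos.
  (* In the (s, t)-plane the slice is [f] restricted to a complex line, so that the Cauchy-Riemann
     equations apply. *)
  have sE (r : R * R) : slice f (gam r.2) (x + r.1 *: delta_mx 0 i) =
      (f \o @Defs.pi_inv R n1 n2) (z + ((r.1 - s) +i* (r.2 - t)) *: v).
    rewrite -gshift -addrA -scalerDl !(addrC s) !(addrC t) !subrK.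
    exact: sliceE.
  exists a1, b1; split.
    have -> : (fun r : R * R => u (r.2, x + r.1 *: delta_mx 0 i)) = @complex.Re R \o
      (fun r : R * R => (f \o @Defs.pi_inv R n1 n2) (z + ((r.1 - s) +i* (r.2 - t)) *: v)).
      by apply/funext => r; rewrite /u sE.
    exact: DiffDef.
  have -> : (fun r : R * R => w (r.2, x + r.1 *: delta_mx 0 i)) = @complex.Im R \o
    (fun r : R * R => (f \o @Defs.pi_inv R n1 n2) (z + ((r.1 - s) +i* (r.2 - t)) *: v)).
    by apply/funext => r; rewrite /w sE.
  exact: DiffDef.
have bnd (g : R * 'rV[R]_N -> R) : (forall z : R * 'rV[R]_N, 0 < z.1 -> {for z, continuous g}) ->
    (forall z, `|g z| <= normc (slice f (gam z.1) z.2)) -> forall t, 0 < t ->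
    (\int[lebesgue_tuple N]_x `|g (t, row_of_tuple x)|%:E <= M%:E)%E.
  move=> cg gle t t0; apply: le_trans (fM (gpos t t0)); apply: ge0_le_integral => //.
  - apply/measurable_EFinP; apply: measurableT_comp => //.
    apply: (continuous_row_measurable (g := fun x => g (t, x))) => x.
    apply: (@continuous_comp _ _ _ (fun x => (t, x)) g).
      by apply: (@cvg_pair _ _ _ (nbhs x) (nbhs t) (nbhs x) _ _ _); [exact: cvg_cst|exact: cvg_id].
    exact: cg.
  - by apply: measurable_normc; apply: continuousC_slice => //; exact: gpos.
  - by move=> x _; rewrite lee_fin; exact: gle.
have uM := bnd u cu (fun z => normRe_le _).
have wM := bnd w cw (fun z => normIm_le _).
have ba0 : 0 <= b - a by rewrite subr_ge0 ltW.
rewrite -normcN opprB distrC (ger0_norm ba0).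
apply: le_trans (normc_le_ReIm _) _; rewrite mulrDl lerD//.
  apply: le_trans (_ : C1 * (M + M) * (b - a) <= _); last first.
    by rewrite ler_wpM2r// ler_norm.
  have := pairing_lipschitz cu cw CR uM wM cp cq dp dq pC0 qC0 pC1 qC1 a0 ab.
  rewrite /distribution_of /integralC /=.
  by under [X in `|X - _|]eq_Rintegral do rewrite -ReMc;
     under [X in `|_ - X|]eq_Rintegral do rewrite -ReMc.
apply: le_trans (_ : C1 * (M + M) * (b - a) <= _); last first.
  by rewrite ler_wpM2r// ler_norm.
(* The imaginary part of F psi is the real part of F (-i psi), so the same estimate is applied to -i
   psi = q - ip. *)
have cNp : continuous (\- p) by move=> x; exact: (cvgN (cp x)).
have dNp x : derivable (\- p) x (delta_mx 0 i) by exact: derivableN.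
have NpC0 x : `|(\- p) x| <= C0 by rewrite /= normrN.
have NpC1 x : `|'D_(delta_mx 0 i) (\- p) x| <= C1 by rewrite deriveN// normrN.
have := pairing_lipschitz cu cw CR uM wM cq cNp dq dNp qC0 NpC0 qC1 NpC1 a0 ab.
rewrite /distribution_of /integralC /=.
by under [X in `|X - _|]eq_Rintegral do rewrite mulrN opprK -ImMc;
   under [X in `|_ - X|]eq_Rintegral do rewrite mulrN opprK -ImMc.
Qed.

End hardy_pairing.

(** * Limits at the corner (0, 0) of the quadrant of times *)

Section corner_limit.
Context {R : realType}.
Local Notation corner := (filter_prod (0 : R)^'+ (0 : R)^'+).

Lemma near_corner (d : R) : 0 < d ->
  \forall t \near corner, (0 < t.1 < d) /\ (0 < t.2 < d).
Proof.
move=> d0; have h : \forall s \near (0 : R)^'+, 0 < s < d.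
  by apply: filterS2 (nbhs_right_gt 0) (nbhs_right_lt d0) => s -> ->.
by exists ([set s | 0 < s < d], [set s | 0 < s < d]).
Qed.

Lemma corner_pos2 : \forall t \near corner, pos2 t.
Proof.
by apply: filterS (near_corner ltr01) => t [/andP[? _] /andP[? _]].
Qed.

(** Near the corner all values are close to the one at a diagonal point (d, d), so the image filter
    is Cauchy and completeness gives a limit. *)
Lemma lipschitz_corner_cvgR (h : R * R -> R) (K : R) : 0 <= K ->
  (forall t t', pos2 t -> pos2 t' ->
    `|h t - h t'| <= K * (`|t.1 - t'.1| + `|t.2 - t'.2|)) ->
  cvg (h t @[t --> corner]).
Proof.
move=> K0 hK; apply/cauchy_cvgP; apply: cauchy_exP => eps /= eps0.
have K10 : 0 < K + 1 by rewrite ltr_wpDl.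
(* Each of the two times differs from d by less than d; K + 1 is positive even when [K] is 0. *)
pose d := eps / 2 / (K + 1); have d0 : 0 < d by rewrite !divr_gt0.
exists (h (d, d)); rewrite near_simpl.
apply: filterS (near_corner d0) => t [/andP[t1 td1] /andP[t2 td2]].
rewrite /ball/=; apply: le_lt_trans (hK _ _ _ _) _ => //=.
have h1 : `|d - t.1| + `|d - t.2| < d + d.
  by rewrite ltrD// ltr_norml; apply/andP; split; lra.
apply: le_lt_trans (_ : (K + 1) * (`|d - t.1| + `|d - t.2|) < _).
  by rewrite ler_wpM2r ?addr_ge0// lerDl.
rewrite -ltr_pdivlMl//; apply: lt_le_trans h1 _.
by rewrite /d -mulrDl -splitr mulrC.
Qed.

Lemma lipschitz_corner_cvg (g : R * R -> R[i]^o) (K : R) : 0 <= K ->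
  (forall t t', pos2 t -> pos2 t' ->
    normc (g t - g t') <= K * (`|t.1 - t'.1| + `|t.2 - t'.2|)) ->
  cvg (g t @[t --> corner]).
Proof.
move=> K0 gK.
have cR : cvg (complex.Re (g t) @[t --> corner]).
  apply: (lipschitz_corner_cvgR K0) => t t' t0 t'0; apply: le_trans (gK t t' t0 t'0).
  by apply: le_trans (normRe_le _); case: (g t) (g t') => ? ? [].
have cI : cvg (complex.Im (g t) @[t --> corner]).
  apply: (lipschitz_corner_cvgR K0) => t t' t0 t'0; apply: le_trans (gK t t' t0 t'0).
  by apply: le_trans (normIm_le _); case: (g t) (g t') => ? ? [].
apply: (cvgP (lim (complex.Re (g t) @[t --> corner]) +i*
  lim (complex.Im (g t) @[t --> corner]) : R[i]^o)).
by apply/cvg_complexP; split.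
Qed.

Lemma corner_normc_le (g : R * R -> R[i]^o) (l : R[i]^o) (B : R) :
  g t @[t --> corner] --> l -> (forall t, pos2 t -> normc (g t) <= B) ->
  normc l <= B.
Proof.
move=> gl gB; apply/ler_addgt0Pr => e e0.
have e0C : 0 < (e%:C : R[i]) by rewrite ltcR.
have /cvgrPdist_le/(_ _ e0C) lg := gl.
have [t [lt /gB gt]] := filter_ex (filterI lg corner_pos2).
rewrite normc_norm lecR in lt.
rewrite -(subrK (g t) l) (le_trans (le_normcD _ _))// addrC lerD//.
Qed.

End corner_limit.

Lemma hardy1_bound (R : realType) (n1 n2 : nat)
    (f : (R * R) * (heis R n1 * heis R n2) -> R[i]^o) : hardy1 f ->
  exists M : R, forall t, pos2 t ->
  (\int[lebesgue_tuple (heis_dim n1 + heis_dim n2)]_x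
     (normc (slice f t (row_of_tuple x)))%:E <= M%:E)%E.
Proof.
move=> [_ fin]; exists (fine (hardy1_norm f)) => t t0.
have h : (\int[lebesgue_tuple (heis_dim n1 + heis_dim n2)]_x
     (normc (slice f t (row_of_tuple x)))%:E <= hardy1_norm f)%E.
  by apply: ereal_sup_ubound; exists t.
(* The norm is below +oo by hypothesis, and nonnegative because it bounds the integral of a
   nonnegative function. *)
rewrite fineK// fin_numE (lt_eqF fin) andbT gt_eqF// (lt_le_trans _ h)//.
apply: lt_le_trans (ltNyr 0) _; apply: integral_ge0 => x _.
by rewrite lee_fin (le_trans (normr_ge0 _) (normRe_le _)).
Qed.

Theorem theorem5p1 (R : realType) (n1 n2 : nat)
    (hn1 : (1 <= n1)%N) (hn2 : (1 <= n2)%N)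
    (f : (R * R) * (heis R n1 * heis R n2) -> R[i]^o) (hf : hardy1 f) :
  exists2 fb : ('rV[R]_(heis_dim n1 + heis_dim n2) -> R[i]^o) -> R[i]^o,
    tempered fb &
    cvg_tempered (filter_prod 0^'+ 0^'+)
      (fun eps : R * R => distribution_of (slice f eps)) fb.
Proof.
have [M fM] := hardy1_bound hf; have [holf _] := hf.
pose A t psi := distribution_of (slice f t) psi.
have cslice t : pos2 t -> continuousC (slice f t) by exact: continuousC_slice.
have A_cvg psi : schwartz psi -> cvg (A t psi @[t --> filter_prod (0 : R)^'+ (0 : R)^'+]).
  move=> spsi.
  have [K1 K10 hK1] := distribution_of_slice_lipschitz holf fM (center1 (n1 := n1) (n2 := n2)) spsi.
  have [K2 K20 hK2] := distribution_of_slice_lipschitz holf fM (center2 (n1 := n1) (n2 := n2)) spsi.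
  have AK t1 t2 t1' t2' : 0 < t1 -> 0 < t2 -> 0 < t1' -> 0 < t2' ->
      normc (A (t1, t2) psi - A (t1', t2') psi) <=
      (K1 + K2) * (`|t1 - t1'| + `|t2 - t2'|).
    move=> t10 t20 t1'0 t2'0.
    (* Through the intermediate point (t1', t2), so that one time moves at a time. *)
    rewrite -(subrK (A (t1', t2) psi) (A (t1, t2) psi)) -addrA.
    apply: le_trans (le_normcD _ _) _.
    rewrite mulrDl; apply: lerD.
      apply: le_trans (hK1 (fun t => (t, t2)) ((1, 0), 0) _ _ _ t1 t1' t10 t1'0) _.
      - by move=> t t0; split.
      - by move=> t; apply: (@cvg_pair _ _ _ (nbhs t) (nbhs t) (nbhs t2) _ _ _);
          [exact: cvg_id|exact: cvg_cst].
      - by move=> t dt s x; exact: siegel2_point_shift1.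
      - by rewrite ler_wpM2l// lerDl.
    apply: le_trans (hK2 (fun t => (t1', t)) (0, (1, 0)) _ _ _ t2 t2' t20 t2'0) _.
    - by move=> t t0; split.
    - by move=> t; apply: (@cvg_pair _ _ _ (nbhs t) (nbhs t1') (nbhs t) _ _ _);
        [exact: cvg_cst|exact: cvg_id].
    - by move=> t dt s x; exact: siegel2_point_shift2.
    - by rewrite ler_wpM2l// lerDr.
  apply: (lipschitz_corner_cvg (K := K1 + K2)); first by rewrite addr_ge0.
  by move=> [t1 t2] [t1' t2'] [t10 t20] [t1'0 t2'0]; exact: AK.
(* Outside the Schwartz space [lim] may be a junk value, which is harmless since only Schwartz
   functions are tested. *)
pose fb psi : R[i]^o := lim (A t psi @[t --> filter_prod (0 : R)^'+ (0 : R)^'+]).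
have A_fb psi : schwartz psi ->
    A t psi @[t --> filter_prod (0 : R)^'+ (0 : R)^'+] --> fb psi by exact: A_cvg.
exists fb; last first.
  split=> //; apply: filterS corner_pos2 => t t0.
  exact: tempered_distribution_of (cslice t t0) (fM t t0).
(* Linearity and the Lipschitz bound in the supremum norm, with a constant independent of t, both
   pass to the limit. *)
apply: (lipschitz_tempered (K := M + M)) => [c phi psi sphi spsi|phi psi C sphi spsi C_le].
  apply: (@cvg_lim R[i]^o); first exact: norm_hausdorff.
  have h := cvgD (cvgM (cvg_cst (c : R[i]^o)) (A_fb phi sphi)) (A_fb psi spsi).
  (* Linearity of [A t] is available at positive times, hence eventually along the corner filter. *)
  move=> P /h hP; apply: filterS2 corner_pos2 hP => t t0 hP.
  exact: (@eq_ind_r _ _ P hP _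
    (distribution_of_linear (cslice t t0) (fM t t0) c sphi spsi)).
apply: corner_normc_le (cvgB (A_fb phi sphi) (A_fb psi spsi)) _ => t t0.
exact: (distribution_of_lipschitz (cslice t t0) (fM t t0)).
Qed.
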